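(* Let $K_1\subset\mathbb{R}^k$ and $K_2,K_3\subset\mathbb{R}^d$ be compact. Let $\nu$ be a Borel probability measure on $K_1\times K_2$ whose first marginal $m$ is centered, $\int_{K_1}\tilde x\,m(d\tilde x)=0$, and let $\mu$ be a Borel probability measure on $K_3$. Let $MI(\mu,\nu)$ be the set of Borel probability measures $\theta$ on $K_1\times K_2\times K_3$ whose $(\tilde x,y)$-marginal is $\nu$, whose $u$-marginal is $\mu$, and such that $\int v(u)^\top\tilde x\,\theta(d\tilde x,dy,du)=0$ for all $v\in C(K_3,\mathbb{R}^k)$. Then $$\max_{\theta\in MI(\mu,\nu)}\int u^\top y\,\theta(d\tilde x,dy,du)=\inf\Big\{\int_{K_1\times K_2}\psi\,d\nu+\int_{K_3}\varphi\,d\mu\Big\},$$ where the infimum is over $(\psi,\varphi,v)\in C(K_1\times K_2)\times C(K_3)\times C(K_3,\mathbb{R}^k)$ satisfying $\psi(\tilde x,y)+\varphi(u)+v(u)^\top\tilde x\ge u^\top y$ for all $(\tilde x,y,u)\in K_1\times K_2\times K_3$ (and the maximum is attained). This common value also equals the infimum of the same objective over $(\psi,\varphi,v)\in L^1(\nu)\times L^1(\mu)\times L^1(\mu,\mathbb{R}^k)$ satisfying the same constraint. *)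

(* Defs.v *)
From HB Require Import structures.
From mathcomp Require Import all_boot all_order all_algebra.
From mathcomp Require Import all_classical all_reals all_analysis.
Set Implicit Arguments. Unset Strict Implicit. Unset Printing Implicit Defensive.
Import Order.TTheory GRing.Theory Num.Theory.
Import numFieldNormedType.Exports.
Local Open Scope classical_set_scope.
Local Open Scope ring_scope.

(* R^n is represented by row vectors 'rV[R]_n (with their normed topology).
   Brv R n is the same carrier equipped with the Borel sigma-algebra
   (sigma-algebra generated by the open sets of 'rV[R]_n). *)
Definition Brv (R : realType) (n : nat) := g_sigma_algebraType (@open 'rV[R]_n).

Definition dotp (R : realType) (n : nat) (u y : 'rV[R]_n) : R :=
  \sum_(i < n) u 0 i * y 0 i.

Section Defs.
Context (R : realType) (k d : nat).
Local Notation X := (Brv R k).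
Local Notation Y := (Brv R d).
Local Notation U := (Brv R d).
Local Open Scope ereal_scope.

(* MI(mu, nu): Borel probability measures theta on K1 x K2 x K3
   (realized as probabilities on (R^k x R^d) x R^d) whose (x~,y)-marginal is
   nu, whose u-marginal is mu, and with int v(u)^T x~ dtheta = 0 for all
   v in C(K3, R^k). *)
Definition MI (K1 : set 'rV[R]_k) (K2 K3 : set 'rV[R]_d)
  (nu : probability (X * Y)%type R) (mu : probability U R)
  (theta : probability ((X * Y) * U)%type R) : Prop :=
  [/\ (forall A : set (X * Y)%type, measurable A -> theta (A `*` setT) = nu A),
      (forall B : set U, measurable B -> theta (setT `*` B) = mu B) &
      (forall v : 'rV[R]_d -> 'rV[R]_k, {within K3, continuous v} ->
         \int[theta]_(z in (K1 `*` K2) `*` K3) (dotp (v z.2) z.1.1)%:E = 0)].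

Definition primal_obj (K1 : set 'rV[R]_k) (K2 K3 : set 'rV[R]_d)
  (theta : probability ((X * Y) * U)%type R) : \bar R :=
  \int[theta]_(z in (K1 `*` K2) `*` K3) (dotp z.2 z.1.2)%:E.

Definition dual_constraint (K1 : set 'rV[R]_k) (K2 K3 : set 'rV[R]_d)
  (psi : 'rV[R]_k * 'rV[R]_d -> R) (phi : 'rV[R]_d -> R)
  (v : 'rV[R]_d -> 'rV[R]_k) : Prop :=
  forall (x : 'rV[R]_k) (y u : 'rV[R]_d), K1 x -> K2 y -> K3 u ->
    (psi (x, y) + phi u + dotp (v u) x >= dotp u y)%R.

Definition dual_obj (K1 : set 'rV[R]_k) (K2 K3 : set 'rV[R]_d)
  (nu : probability (X * Y)%type R) (mu : probability U R)
  (psi : 'rV[R]_k * 'rV[R]_d -> R) (phi : 'rV[R]_d -> R) : \bar R :=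
  \int[nu]_(z in K1 `*` K2) (psi z)%:E + \int[mu]_(u in K3) (phi u)%:E.

Definition dual_values_C (K1 : set 'rV[R]_k) (K2 K3 : set 'rV[R]_d)
  (nu : probability (X * Y)%type R) (mu : probability U R) : set (\bar R) :=
  [set r | exists (psi : 'rV[R]_k * 'rV[R]_d -> R) (phi : 'rV[R]_d -> R)
                  (v : 'rV[R]_d -> 'rV[R]_k),
     [/\ {within K1 `*` K2, continuous psi}, {within K3, continuous phi},
         {within K3, continuous v}, dual_constraint K1 K2 K3 psi phi v &
         r = dual_obj K1 K2 K3 nu mu psi phi]].

Definition dual_values_L1 (K1 : set 'rV[R]_k) (K2 K3 : set 'rV[R]_d)
  (nu : probability (X * Y)%type R) (mu : probability U R) : set (\bar R) :=
  [set r | exists (psi : 'rV[R]_k * 'rV[R]_d -> R) (phi : 'rV[R]_d -> R)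
                  (v : 'rV[R]_d -> 'rV[R]_k),
     [/\ nu.-integrable (K1 `*` K2) (fun z : (X * Y)%type => (psi z)%:E),
         mu.-integrable K3 (fun u : U => (phi u)%:E),
         (forall i : 'I_k, mu.-integrable K3 (fun u : U => (v u 0 i)%:E)),
         dual_constraint K1 K2 K3 psi phi v &
         r = dual_obj K1 K2 K3 nu mu psi phi]].

End Defs.

(* Main.v *)
Require Import Defs.
From HB Require Import structures.
From mathcomp Require Import all_boot all_order all_algebra.
From mathcomp Require Import all_classical all_reals all_analysis.
From mathcomp Require Import finmap measurable_realfun ring lra.
Import Order.TTheory GRing.Theory Num.Theory.
Import numFieldNormedType.Exports.
Local Open Scope classical_set_scope.
Local Open Scope ring_scope.

(* Let [pi] be a continuous surjection of the Cantor space onto K1 x K2 x K3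
   (Alexandroff-Hausdorff). For a bounded function f on the Cantor space let p(f)
   be the infimum of the dual objective over the continuous (psi, phi, v) such that
   psi + phi + v . x dominates f along [pi]. Since the first marginal of nu is
   centered, p is finite, and it is sublinear; so Hahn-Banach yields a linear
   L <= p which agrees with p at the cost u . y. Such an L is positive and takes
   the value of the dual objective on the functions psi + phi + v . x. On the
   algebra of clopen sets A |-> L(1_A) is finitely additive, hence countably
   additive by compactness; its Caratheodory extension represents L on continuous
   functions, and the image of this measure under [pi] is an optimal theta.

   For the duals in L^1, only int w(u) x_i dtheta = 0 for w in L^1(mu) has to be
   added to weak duality: for |x_i| <= M, the images under u of the positive
   measures (x_i + M) theta and M theta integrate all continuous functions equally,
   so they coincide. *)

(** * Hahn-Banach theorem *)

Section hahn_banach.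
Context {R : realType} {V : lmodType R} (D : set V).
Hypothesis DD : forall f g, D f -> D g -> D (f + g).
Hypothesis DZ : forall (t : R) f, D f -> D (t *: f).

(** Homogeneity is asked only as an inequality, which is what infima readily give; equality follows
    by using it again with the factor [t^-1]. *)
Definition sublinear (q : V -> R) :=
  (forall f g, D f -> D g -> q (f + g) <= q f + q g) /\
  (forall t f, 0 <= t -> D f -> q (t *: f) <= t * q f).

Let DN f : D f -> D (- f).
Proof. by move=> Df; rewrite -scaleN1r; exact: DZ. Qed.

Lemma sublinearZ q t f : sublinear q -> 0 <= t -> D f -> q (t *: f) = t * q f.
Proof.
move=> [qD qZ] t0 Df; apply/eqP; rewrite eq_le qZ//=.
have [->|tn0] := eqVneq t 0.
  rewrite mul0r scale0r.
  have D0 : D 0 by rewrite -(scale0r f); exact: DZ.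
  by have := qD _ _ D0 D0; rewrite addr0; lra.
have tp : 0 < t by rewrite lt_neqAle eq_sym tn0.
have := qZ t^-1 (t *: f); rewrite invr_ge0 => /(_ t0 (DZ _ _ Df)).
by rewrite scalerA mulVf// scale1r mulrC ler_pdivlMr// mulrC.
Qed.

Lemma sublinearN q f : sublinear q -> D f -> - q (- f) <= q f.
Proof.
move=> sq Df; have /= := sq.1 _ _ Df (DN _ Df).
rewrite subrr -(scale0r f) (sublinearZ _ _ _ sq)// mul0r; lra.
Qed.

(** Every linear minorant of [q] that agrees with [q] at [c] lies below each term of this infimum.
    Passing to the tilt keeps sublinearity and pushes the value at [- c] down to at most [- q c]. *)
Definition tilt (q : V -> R) (c f : V) : R :=
  inf [set q (f + t *: c) - t * q c | t in [set t | 0 <= t]].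

Section tilt_props.
Context (q : V -> R) (c : V).
Hypotheses (sq : sublinear q) (Dc : D c).

Let tilt_lb f : D f ->
  has_lbound [set q (f + t *: c) - t * q c | t in [set t | 0 <= t]].
Proof.
move=> Df; exists (- q (- f)) => _ [t /= t0 <-].
(* Subadditivity for [t *: c] written as the sum of [f + t *: c] and [- f]. *)
have := sq.1 _ _ (DD _ _ Df (DZ t _ Dc)) (DN _ Df).
rewrite addrAC subrr add0r (sublinearZ _ _ _ sq)//; lra.
Qed.

Let tilt_le t f : D f -> 0 <= t -> tilt q c f <= q (f + t *: c) - t * q c.
Proof. by move=> Df t0; apply: ge_inf; [exact: tilt_lb|exists t]. Qed.

Let le_tilt (y : R) f :
  (forall t, 0 <= t -> y <= q (f + t *: c) - t * q c) -> y <= tilt q c f.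
Proof.
move=> h; apply: lb_le_inf; last by move=> _ [t /= t0 <-]; exact: h.
by eexists; exists 0 => //=.
Qed.

Lemma tilt_le_id f : D f -> tilt q c f <= q f.
Proof.
move=> Df; have := tilt_le 0 f Df (lexx _).
by rewrite scale0r addr0 mul0r subr0.
Qed.

Lemma tilt_opp : tilt q c (- c) <= - q c.
Proof.
have := tilt_le 1 (- c) (DN _ Dc) ler01.
rewrite scale1r addNr mul1r -(scale0r c) (sublinearZ _ _ _ sq)//; lra.
Qed.

(** Parameters [s] for [f] and [t] for [g] combine to the parameter [s + t] for [f + g]; for
    [t *: f] the parameter [s] is rescaled to [t * s]. *)
Lemma sublinear_tilt : sublinear (tilt q c).
Proof.
split=> [f g Df Dg|t f t0 Df].
- rewrite -lerBlDr; apply: le_tilt => s s0; rewrite lerBlDr -lerBlDl.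
  apply: le_tilt => t t0; rewrite lerBlDl.
  have := tilt_le (s + t) (f + g) (DD _ _ Df Dg) (addr_ge0 s0 t0).
  have := sq.1 _ _ (DD _ _ Df (DZ s _ Dc)) (DD _ _ Dg (DZ t _ Dc)).
  rewrite addrACA -scalerDl; lra.
- have [->|tn0] := eqVneq t 0.
    rewrite mul0r scale0r; apply: le_trans (tilt_le_id _ _) _.
      by rewrite -(scale0r f); exact: DZ.
    by rewrite -(scale0r f) (sublinearZ _ _ _ sq)// mul0r.
  have tp : 0 < t by rewrite lt_neqAle eq_sym tn0.
  rewrite -ler_pdivrMl//; apply: le_tilt => s s0.
  rewrite ler_pdivrMl//.
  apply: le_trans (tilt_le (t * s) (t *: f) (DZ _ _ Df) (mulr_ge0 t0 s0)) _.
  rewrite -scalerA -scalerDr (sublinearZ _ _ _ sq)//; first by rewrite mulrBr mulrA.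
  by apply: DD => //; exact: DZ.
Qed.

End tilt_props.

(* A minimal sublinear functional equals all of its tilts, hence is odd. *)
Lemma sublinear_minorant (q0 : V -> R) : sublinear q0 ->
  exists L : V -> R, [/\ forall f g, D f -> D g -> L (f + g) = L f + L g,
    forall t f, D f -> L (t *: f) = t * L f & forall f, D f -> L f <= q0 f].
Proof.
move=> sq0.
pose T := {q : V -> R | sublinear q /\ forall f, D f -> q f <= q0 f}.
pose t0 : T := exist _ q0 (conj sq0 (fun f _ => lexx (q0 f))).
(* The order is reversed, so that a maximal element given by Zorn's lemma is a pointwise minimal
   functional. *)
pose r (a b : T) := `[< forall f, D f -> sval b f <= sval a f >].
have [||A totA|[q [sq qq0]] qmin] := @ZL_preorder T t0 r.
- by move=> t; apply/asboolP => f _.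
- move=> a b c /asboolP ab /asboolP bc; apply/asboolP => f Df.
  exact: le_trans (bc _ Df) (ab _ Df).
- have [[a0 Aa0]|A0] := pselect (exists a, A a); last first.
    by exists t0 => s As; exfalso; apply: A0; exists s.
  (* A chain is bounded by its pointwise infimum, which is finite because every member is at least
     [- q0 (- f)] at [f]. *)
  pose m f := inf [set sval a f | a in A].
  have mlb f : D f -> has_lbound [set sval a f | a in A].
    move=> Df; exists (- q0 (- f)) => _ [[a [sa aq]] _ <-] /=.
    by apply: le_trans (sublinearN _ _ sa Df); rewrite lerN2; apply: aq; exact: DN.
  have mle a f : D f -> A a -> m f <= sval a f.
    by move=> Df Aa; apply: ge_inf; [exact: mlb|exists a].
  have lem y f : (forall a, A a -> y <= sval a f) -> y <= m f.
    move=> h; apply: lb_le_inf; first by exists (sval a0 f); exists a0.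
    by move=> _ [a Aa <-]; exact: h.
  have sm : sublinear m.
    split=> [f g Df Dg|t f tp Df].
    + rewrite -lerBlDr; apply: (lem _ f) => a Aa; rewrite lerBlDr -lerBlDl.
      apply: (lem _ g) => b Ab; rewrite lerBlDl.
      (* Here the chain condition enters: the smaller of [a] and [b], evaluated at [f + g], is at
         most [a f + b g]. *)
      have [/asboolP ab|/asboolP ba] := totA a b Aa Ab.
      * apply: le_trans (mle b _ (DD _ _ Df Dg) Ab) _.
        apply: le_trans ((svalP b).1.1 f g Df Dg) _.
        by rewrite lerD2r ab.
      * apply: le_trans (mle a _ (DD _ _ Df Dg) Aa) _.
        apply: le_trans ((svalP a).1.1 f g Df Dg) _.
        by rewrite lerD2l ba.
    + have [->|tn0] := eqVneq t 0.
        rewrite mul0r; apply: le_trans (mle _ _ (DZ _ _ Df) Aa0) _.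
        by rewrite (sublinearZ _ _ _ (svalP a0).1)// mul0r.
      have t_gt0 : 0 < t by rewrite lt_neqAle eq_sym tn0.
      rewrite -ler_pdivrMl//; apply: lem => a Aa; rewrite ler_pdivrMl//.
      apply: le_trans (mle _ _ (DZ _ _ Df) Aa) _.
      by rewrite (sublinearZ _ _ _ (svalP a).1).
  have mq0 f : D f -> m f <= q0 f.
    by move=> Df; apply: le_trans (mle _ _ Df Aa0) _; exact: (svalP a0).2.
  exists (exist _ m (conj sm mq0)) => a Aa; apply/asboolP => f Df /=; exact: mle.
(* The tilt of [q] at [c] competes with [q], so minimality gives [q <= tilt q c]; at [- c] this
   yields the inequality missing for oddness. *)
have qN c : D c -> q (- c) = - q c.
  move=> Dc; apply/eqP; rewrite eq_le; apply/andP; split; last first.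
    by have := sublinearN q (- c) sq (DN _ Dc); rewrite opprK; lra.
  have tq : forall f, D f -> tilt q c f <= q0 f.
    by move=> f Df; apply: le_trans (qq0 f Df); exact: tilt_le_id.
  pose tqT : T := exist _ (tilt q c) (conj (sublinear_tilt q c sq Dc) tq).
  have /qmin/asboolP/(_ _ (DN _ Dc)) h : r (exist _ q (conj sq qq0)) tqT.
    by apply/asboolP => f Df /=; exact: tilt_le_id.
  exact: le_trans h (tilt_opp q c sq Dc).
exists q; split => // [f g Df Dg|t f Df].
(* Superadditivity: subadditivity for [f] as the sum of [f + g] and [- g], together with oddness. *)
- apply/eqP; rewrite eq_le sq.1//=.
  have := sq.1 _ _ (DD _ _ Df Dg) (DN _ Dg).
  by rewrite addrK qN//; lra.
- have [t_ge0|/ltW t_le0] := leP 0 t; first exact: sublinearZ.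
  have := sublinearZ q (- t) f sq; rewrite oppr_ge0 => /(_ t_le0 Df).
  by rewrite scaleNr qN ?mulNr; [move/oppr_inj|exact: DZ].
Qed.

(** A linear minorant of the tilt of [p] at [c], rather than of [p] itself, satisfies
    [L (- c) <= - p c], which forces [L c = p c]. *)
Theorem hahn_banach_dominated (p : V -> R) (c : V) : sublinear p -> D c ->
  exists L : V -> R, [/\ forall f g, D f -> D g -> L (f + g) = L f + L g,
    forall t f, D f -> L (t *: f) = t * L f, forall f, D f -> L f <= p f &
    L c = p c].
Proof.
move=> sp Dc.
have [L [LD LZ Lp]] := sublinear_minorant _ (sublinear_tilt p c sp Dc).
exists L; split => // [f Df|].
  exact: le_trans (Lp f Df) (tilt_le_id p c sp Dc f Df).
apply/eqP; rewrite eq_le; apply/andP; split.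
  exact: le_trans (Lp c Dc) (tilt_le_id p c sp Dc c Dc).
have := le_trans (Lp (- c) (DN _ Dc)) (tilt_opp p c sp Dc).
by rewrite -scaleN1r LZ// mulN1r lerN2.
Qed.

End hahn_banach.

(** * Riesz representation on the Cantor space *)

Definition bounded_function {R : realType} {T : Type} : set (T -> R) :=
  [set f | exists M, forall x, `|f x| <= M].

Lemma bounded_functionD {R : realType} {T : Type} (f g : T -> R) :
  bounded_function f -> bounded_function g -> bounded_function (f + g).
Proof.
move=> [M fM] [N gN]; exists (M + N) => x /=.
by apply: le_trans (ler_normD _ _) _; exact: lerD.
Qed.

Lemma bounded_functionZ {R : realType} {T : Type} (t : R) (f : T -> R) :
  bounded_function f -> bounded_function (t *: f).
Proof.
move=> [M fM]; exists (`|t| * M) => x /=.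
by rewrite normrM ler_wpM2l.
Qed.

Lemma bounded_measurable_integrable {R : realType} (d : measure_display)
    (T : measurableType d) (m : {finite_measure set T -> \bar R}) (D : set T)
    (f : T -> R) (M : R) : measurable D -> measurable_fun D f ->
  (forall x, D x -> `|f x| <= M) -> m.-integrable D (EFin \o f).
Proof.
move=> mD mf fM; apply: measurable_bounded_integrable => //.
  by rewrite ltey_eq fin_num_measure.
exists M; split; first exact: num_real.
by move=> y My x Dx; apply: le_trans (ltW My); exact: fM.
Qed.

(** The map [e] links a measurable structure and a topology that live on different types; in the
    applications it is the identity of a common carrier. *)
Lemma within_continuous_measurable {R : realType} {V : topologicalType}
    (d : measure_display) (T : measurableType d) (e : T -> V) (A : set V)
    (g : V -> R) :
  (forall O, open O -> measurable (e @^-1` O)) -> measurable (e @^-1` A) ->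
  {within A, continuous g} -> measurable_fun (e @^-1` A) (g \o e).
Proof.
move=> me mA /continuousP cg.
apply: (measurability _ (RGenOInfty.measurableE R)) => _ [_ [a ->] <-].
have /open_subspaceP[W oW WA] := cg _ (@open_gt R a).
suff -> : e @^-1` A `&` (g \o e) @^-1` `]a, +oo[ = e @^-1` (W `&` A).
  by rewrite preimage_setI; apply: measurableI => //; exact: me.
rewrite WA setIC; congr (_ `&` _).
by apply/seteqP; split => x /=; rewrite in_itv/= andbT.
Qed.

Lemma compact_within_continuous_bounded {R : realType} {V : topologicalType}
    (A : set V) (g : V -> R) : compact A -> {within A, continuous g} ->
  exists M, forall x, A x -> `|g x| <= M.
Proof.
move=> cA cg; have /compact_bounded[M [Mr /(_ (M + 1))]] := continuous_compact cg cA.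
rewrite ltrDl ltr01 => /(_ isT) h; exists (M + 1) => x Ax.
by apply: h; exists x.
Qed.

Lemma countable_bigcup_measurable (d : measure_display) (T : measurableType d)
    (S : set (set T)) : countable S -> (forall C, S C -> measurable C) ->
  measurable (\bigcup_(C in S) C).
Proof.
move=> /pfcard_geP[->|/surjfunPex[f ->]] mS; first by rewrite bigcup_set0.
by rewrite bigcup_image; apply: bigcupT_measurable => n; apply: mS; exists n.
Qed.

Lemma cantor_continuous_bounded {R : realType} (g : cantor_space -> R) :
  continuous g -> bounded_function g.
Proof.
move=> cg; have [M gM] := compact_within_continuous_bounded _ _ cantor_space_compact
    (continuous_subspaceT cg).
by exists M => x; exact: gM.
Qed.

Section cantor_riesz.
Context {R : realType}.

Lemma cantor_second_countable : @second_countable cantor_space.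
Proof.
pose T : pseudoPMetricType R := HB.pack cantor_space
  (PseudoMetric.on (prod_topology (fun _ : nat => bool))).
exact: (@compact_second_countable R T cantor_space_compact).
Qed.

Lemma cantor_clopen_basis (U : set cantor_space) x : open U -> U x ->
  exists C, [/\ clopen C, C x & C `<=` U].
Proof.
move=> oU Ux.
have [|C [Cx clC] CU] := @zero_dimensional_cvg cantor_space x cantor_space_hausdorff
  cantor_zero_dimensional cantor_space_compact U.
  exact: open_nbhs_nbhs.
by exists C.
Qed.

(** Induction by compactness: the clopen neighbourhoods with property [P] cover the space, and
    finitely many of them already do. *)
Lemma cantor_clopen_ind (P : set cantor_space -> Prop) :
  P set0 -> (forall A B, clopen A -> clopen B -> P A -> P B -> P (A `|` B)) ->
  (forall x, exists C, [/\ clopen C, C x & P C]) -> P setT.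
Proof.
move=> P0 PU Px.
have [f /all_and3[clf fx Pf]] := choice Px.
have : cover_compact [set: cantor_space].
  by rewrite -compact_cover; exact: cantor_space_compact.
move=> /(_ _ setT f)[i _||D _ DT]; first by case: (clf i).
  by move=> x _; exists x.
(* Clopenness is carried through the induction because stability of [P] under unions is only assumed
   for clopen sets. *)
have [] : (fun A => clopen A /\ P A) (\big[setU/set0]_(i <- D) f i).
  apply: (big_ind (fun A => clopen A /\ P A)); last by move=> i _; split.
    by split => //; exact: clopen0.
  by move=> A B [clA PA] [clB PB]; split; [exact: clopenU|exact: PU].
rewrite -bigcup_fset => _; suff -> : \bigcup_(i in [set` D]) f i = setT by [].
by apply/seteqP; split => // x _; exact: DT.
Qed.

(** An alias of the Cantor space on which [measurable] means clopen. The clopen sets form an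
    algebra, from which [cantor_borel] is generated. *)
Definition cantor_algebra : Type := cantor_space.

HB.instance Definition _ := Pointed.on cantor_algebra.

Lemma cantor_clopenU : setU_closed (@clopen cantor_space).
Proof. exact: clopenU. Qed.

Lemma cantor_clopenC : setC_closed (@clopen cantor_space).
Proof. by move=> A; exact: (clopenC set0). Qed.

HB.instance Definition _ := isAlgebraOfSets.Build default_measure_display
  cantor_algebra clopen0 cantor_clopenU cantor_clopenC.

Definition cantor_borel := g_sigma_algebraType (@measurable _ cantor_algebra).

(** A compact second countable space has only countably many clopen sets, so an open set is a
    countable union of clopen ones. *)
Lemma cantor_open_measurable (U : set cantor_space) :
  open U -> measurable (U : set cantor_borel).
Proof.
move=> oU.
have -> : U = \bigcup_(C in [set C | clopen C /\ C `<=` U]) C.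
  apply/seteqP; split => [x Ux|x [C [_ CU] Cx]]; last exact: CU.
  by have [C [? ? ?]] := cantor_clopen_basis U x oU Ux; exists C.
apply: countable_bigcup_measurable; last first.
  by move=> C [clC _]; exact: sub_sigma_algebra.
apply: sub_countable (clopen_countable cantor_space_compact cantor_second_countable).
by apply: subset_card_le => C [].
Qed.

Variable L : (cantor_space -> R) -> R.
Hypothesis LD : forall f g, bounded_function f -> bounded_function g ->
  L (f + g) = L f + L g.
Hypothesis LZ : forall t f, bounded_function f -> L (t *: f) = t * L f.
Hypothesis L_ge0 : forall f, bounded_function f -> (forall x, 0 <= f x) -> 0 <= L f.
Hypothesis L1 : L (cst 1) = 1.

Let bM (f g : cantor_space -> R) :
  bounded_function f -> bounded_function g -> bounded_function (f \* g).
Proof.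
move=> [M fM] [N gN]; exists (M * N) => x /=.
by rewrite normrM ler_pM.
Qed.

Let bI (C : set cantor_space) : bounded_function (\1_C : cantor_space -> R).
Proof. by exists 1 => x; rewrite indicE; case: (x \in C); rewrite ?normr1 ?normr0. Qed.

Let L_le f g : bounded_function f -> bounded_function g ->
  (forall x, f x <= g x) -> L f <= L g.
Proof.
move=> bf bg fg.
have := L_ge0 (g + (-1) *: f) (bounded_functionD _ _ bg (bounded_functionZ _ _ bf)).
rewrite LD//; last exact: bounded_functionZ.
rewrite LZ// => h; suff : 0 <= L g + -1 * L f by lra.
by apply: h => x /=; rewrite scaleN1r subr_ge0.
Qed.

(** Since [L] acts linearly on all bounded functions, indicators are directly admissible
    arguments. *)
Definition cantor_content (C : set cantor_algebra) : \bar R := (L \1_C)%:E.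
Local Notation lam := cantor_content.

Let lamU (A B : set cantor_space) : A `&` B = set0 ->
  L \1_(A `|` B) = L \1_A + L \1_B.
Proof.
move=> AB; rewrite -LD//; congr L; apply/funext => x /=.
rewrite !fctE !indicE in_setU.
have : x \notin A `&` B by rewrite AB in_set0.
by rewrite in_setI; case: (x \in A); case: (x \in B) => //= _; rewrite ?addr0 ?add0r.
Qed.

Let lam_ge0 C : (0 <= lam C)%E.
Proof. by rewrite lee_fin; apply: L_ge0 => // x; rewrite indicE. Qed.

Let lam0 : L \1_set0 = 0.
Proof. by have := lamU set0 set0 (setI0 _); rewrite setU0; lra. Qed.

Let lam_semi_additive : measure_function.semi_additive lam.
Proof.
move=> F n _ tF _; elim: n => [|n IH]; first by rewrite !big_ord0 /lam lam0.
rewrite !big_ord_recr/= -IH /lam lamU ?EFinD//.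
rewrite -bigcup_mkord; apply/seteqP; split => // x [[i /= ltin Fi] Fn].
have /trivIsetP/(_ i n I I) := tF; rewrite ltn_eqF// => /(_ isT) /=.
by move=> E; have : (F i `&` F n) x by []; rewrite E.
Qed.

(** A clopen set is compact, so a countable clopen cover of it has a finite subcover; finite
    subadditivity of [L] on indicators then suffices. *)
Let lam_sigma_subadditive : measurable_subset_sigma_subadditive lam.
Proof.
move=> A F mF mA AF.
have : cover_compact (A : set cantor_space).
  rewrite -compact_cover; apply: subclosed_compact cantor_space_compact _ => //.
  by case: mA.
move=> /(_ _ setT F)[i _||D _ AD]; first by case: (mF i).
  by move=> x /AF[n _ Fn]; exists n.
(* The successor makes every index of the finite subcover strictly smaller than [N]. *)
pose N := (\max_(i <- D) i).+1.
apply: le_trans (nneseries_lim_ge N _) => //.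
rewrite big_mkord.
apply: (@le_trans _ _ (lam (\big[setU/set0]_(i < N) F i))).
  rewrite lee_fin; apply: L_le => // x; rewrite !indicE ler_nat.
  have [xA|//] := boolP (x \in A); rewrite mem_set//.
  have [i /= iD Fi] := AD x (set_mem xA).
  rewrite -bigcup_mkord; exists i => //=.
  by rewrite /N ltnS; apply: leq_bigmax_seq.
elim: N => [|n IH]; first by rewrite !big_ord0 /lam lam0.
rewrite !big_ord_recr/=; apply: le_trans (leeD2r _ IH).
rewrite /lam -EFinD lee_fin -LD//.
apply: L_le => [//|//|x].
  exact: bounded_functionD.
rewrite fctE/= !indicE in_setU.
by case: (x \in _); case: (x \in _) => //=; rewrite ?addr0 ?add0r// lerDl.
Qed.

HB.instance Definition _ := isContent.Build _ _ _ lam lam_ge0 lam_semi_additive.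

HB.instance Definition _ :=
  Content_SigmaSubAdditive_isMeasure.Build _ _ _ lam lam_sigma_subadditive.

Let lamE (C : set cantor_space) : clopen C ->
  measure_extension lam (C : set cantor_borel) = (L \1_C)%:E.
Proof. by move=> clC; rewrite /measure_extension measurable_mu_extE. Qed.

Let lamT : measure_extension lam setT = 1%E.
Proof.
rewrite lamE; last exact: clopenT.
by rewrite -[in RHS]L1; congr (L _)%:E; apply/funext => x; rewrite indicT.
Qed.

Local Notation m := (measure_extension lam).

Let intg (g : cantor_space -> R) : continuous g ->
  (m : {measure set cantor_borel -> \bar R}).-integrable setT (EFin \o g).
Proof.
move=> cg; apply: measurable_bounded_integrable => //.
- by rewrite /= lamT ltry.
- apply: (@within_continuous_measurable _ _ _ cantor_borel idfun setT g) => //.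
  - exact: cantor_open_measurable.
  - by rewrite preimage_setT.
  - exact: continuous_subspaceT.
- have [M gM] := compact_within_continuous_bounded _ _ cantor_space_compact
    (continuous_subspaceT cg).
  exists M; split; first exact: num_real.
  by move=> y My x _; apply: le_trans (ltW My); exact: gM.
Qed.

(** One inequality is enough: the reverse one is this inequality for the opposite of [g]. *)
Let L_le_int (g : cantor_space -> R) : continuous g ->
  L g <= Rintegral (m : {measure set cantor_borel -> \bar R}) setT g.
Proof.
move=> cg; apply/ler_addgt0Pr => e e0.
(* [Q] holds on small clopen sets, where [g] oscillates by less than [e], and it is
   stable under unions because both sides are additive over disjoint clopen sets *)
pose Q C := forall C', clopen C' -> C' `<=` C ->
  L (g \* \1_C') <=
  Rintegral (m : {measure set cantor_borel -> \bar R}) C' g + e * L \1_C'.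
have mC (C : set cantor_borel) : clopen C -> measurable C.
  by move=> clC; exact: sub_sigma_algebra.
have ih (h : cantor_space -> R) C : continuous h -> clopen C ->
    (m : {measure set cantor_borel -> \bar R}).-integrable C (EFin \o h).
  by move=> ch clC; apply: integrableS (intg h ch) => //; exact: mC.
have ig C := ih g C cg.
have lamR (C : set cantor_borel) : clopen C -> fine (m C) = L \1_C.
  by move=> clC; rewrite lamE.
have QT : Q setT.
  apply: cantor_clopen_ind.
  - move=> C' _; rewrite subset0 => ->; rewrite lam0 mulr0 addr0 Rintegral_set0.
    have -> : g \* \1_set0 = 0 *: (\1_set0 : cantor_space -> R).
      by apply/funext => x; rewrite fctE/= !indicE in_set0 scaler0 mulr0.
    by rewrite LZ// mul0r.
  - move=> A B clA clB QA QB C' clC' C'AB.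
    have clCA : clopen (C' `&` A) by exact: clopenI.
    have clCA' : clopen (C' `&` ~` A) by apply: clopenI => //; exact: cantor_clopenC.
    (* Since [Q] speaks of all clopen subsets, [C'] can be cut into disjoint pieces, one inside [A]
       and the other inside [B]. *)
    have CE : C' = (C' `&` A) `|` (C' `&` ~` A) by rewrite -setIUr setUv setIT.
    have CI : (C' `&` A) `&` (C' `&` ~` A) = set0 by rewrite setIACA setICr setI0.
    have CAQ := QA _ clCA (@subIsetr _ _ _).
    have CBQ : L (g \* \1_(C' `&` ~` A)) <= Rintegral
        (m : {measure set cantor_borel -> \bar R}) (C' `&` ~` A) g +
        e * L \1_(C' `&` ~` A).
      by apply: QB => // x [/C'AB[]].
    have LE : L (g \* \1_C') = L (g \* \1_(C' `&` A)) + L (g \* \1_(C' `&` ~` A)).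
      rewrite -LD; [|by apply: bM => //; exact: cantor_continuous_bounded..].
      congr L; apply/funext => x; rewrite !fctE/= -mulrDr; congr (_ * _).
      rewrite !indicE !in_setI in_setC.
      by case: (x \in C'); case: (x \in A); rewrite //= ?addr0 ?add0r.
    rewrite LE [in X in _ <= X]CE lamU// Rintegral_setU//.
    + lra.
    + exact: mC.
    + exact: mC.
    + by rewrite -CE; exact: ig.
    + by apply/disj_setPS; rewrite CI.
  (* Near [x] both sides are compared with [g x * L \1_C']; each comparison costs [e / 2] times
     [L \1_C']. *)
  - move=> x; have e20 : 0 < e / 2 by rewrite divr_gt0.
    have oU : open (g @^-1` ball (g x) (e / 2)).
      by move/continuousP : cg; apply; exact: ball_open.
    have [|C [clC Cx CU]] := cantor_clopen_basis _ x oU; first exact: ballxx.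
    exists C; split => // C' clC' C'C.
    have gx y : C' y -> g x - e / 2 <= g y <= g x + e / 2.
      move=> /C'C/CU /=; rewrite -ball_normE/= ltr_distlC => /andP[]; lra.
    have h1 : L (g \* \1_C') <= (g x + e / 2) * L \1_C'.
      rewrite -LZ//; apply: L_le.
      + by apply: bM => //; exact: cantor_continuous_bounded.
      + exact: bounded_functionZ.
      + move=> y; rewrite fctE/= /GRing.scale/= !indicE.
        have [/set_mem/gx/andP[_ h]|_] := boolP (y \in C'); last by rewrite !mulr0.
        by rewrite !mulr1.
    have h2 : (g x - e / 2) * L \1_C' <=
        Rintegral (m : {measure set cantor_borel -> \bar R}) C' g.
      rewrite -lamR// -(Rintegral_cst (m : {measure set cantor_borel -> \bar R}));
        last exact: mC.
      apply: le_Rintegral; [exact: mC| |exact: ig|by move=> y /gx/andP[]].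
      by apply: (ih (cst (g x - e / 2))) => //; exact: cst_continuous.
    lra.
(* On the whole space the error term is exactly [e], because the total mass is 1. *)
have := QT setT clopenT (@subset_refl _ _).
have -> : g \* \1_setT = g by apply/funext => x /=; rewrite indicT mulr1.
rewrite -lamR ?lamT ?mulr1//; exact: clopenT.
Qed.

Lemma cantor_riesz : exists m : probability cantor_borel R,
  forall g : cantor_space -> R, continuous g ->
    (\int[m]_x (g x)%:E = (L g)%:E)%E.
Proof.
pose mP : probability cantor_borel R :=
  HB.pack m (Measure_isProbability.Build _ _ _ m lamT).
exists mP => g cg.
have ig : (m : {measure set cantor_borel -> \bar R}).-integrable setT (EFin \o g).
  exact: intg.
rewrite -(@fineK _ (\int[mP]_x (g x)%:E)%E); last exact: integrable_fin_num ig.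
congr _%:E; apply/eqP; rewrite eq_le L_le_int// andbT.
(* The remaining inequality comes from applying the previous one to [-1 *: g]. *)
have cN : continuous ((-1) *: g).
  by move=> x; rewrite scaleN1r; apply: continuousN; exact: cg.
have := L_le_int _ cN; rewrite LZ; last exact: cantor_continuous_bounded.
have -> := @RintegralZl _ _ _ m setT g (-1) measurableT ig.
by rewrite !mulN1r lerN2.
Qed.

End cantor_riesz.

(** * Compact sets as continuous images of the Cantor space *)

Lemma compact_cantor_image {R : realType} {V : pseudoMetricType R} (K : set V) :
  hausdorff_space V -> compact K -> K !=set0 ->
  exists pi : cantor_space -> V, continuous pi /\ range pi = K.
Proof.
move=> hV cK [x0 Kx0].
(* The Alexandroff-Hausdorff theorem concerns whole spaces, so [K] is made into a space of its own,
   pointed at [x0]; the surjection is then composed with the inclusion. *)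
pose T : pseudoPMetricType R := HB.pack (set_type K)
  (isPointed.Build (set_type K) (exist _ x0 (mem_set Kx0))).
have cT : compact [set: T].
  (* A filter on the subtype is pushed forward to [V], where it clusters at a point of [K];
     relatively open sets are traces of open sets. *)
  move=> F FF _.
  have [|v [Kv clv]] := cK (set_val @ F) _.
    apply: (@filterS _ F _ setT); last exact: filterT.
    by move=> -[t Kt] _ /=; exact: set_mem.
  exists (exist _ v (mem_set Kv)); split => // A B FA.
  move=> [_ [/= [W oW <-] Wv WB]].
  have [||w [[a Aa <-] Ww]] := clv (set_val @` A) W.
    by apply: (@filterS _ F _ A) => // t At; exists t.
    by apply: open_nbhs_nbhs; split.
  by exists a; split => //; exact: WB.
have hT : hausdorff_space T.
  move=> [a Ka] [b Kb] clab; apply/eq_sig_hprop => //=; apply: hV => A B nA nB.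
  have [||z [Az Bz]] := clab (set_val @^-1` A) (set_val @^-1` B).
  - exact: initial_continuous.
  - exact: initial_continuous.
  by exists (set_val z).
have [f cf] := @cantor_surj R T cT hT.
exists (set_val \o f); split.
  by move=> x; apply: continuous_comp; [exact: cf|exact: initial_continuous].
apply/seteqP; split => [_ [x _ <-]|v Kv] /=.
  by case: (f x) => t Kt /=; exact: set_mem.
have [x _ fx] := @surj _ _ _ _ f (exist _ v (mem_set Kv)) I.
by exists x => //=; rewrite fx.
Qed.

(** * Borel measures on row vectors *)

Section closed_approximation.
Context {R : realType} {V : normedModType R}.

Lemma lipschitz1_continuous (f : V -> R) :
  (forall x y, f x <= `|x - y| + f y) -> continuous f.
Proof.
move=> fl x; apply/cvgrPdist_lt => e e0; near=> y.
have xy : `|x - y| < e by near: y; apply: cvgr_dist_lt.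
have := fl x y; have := fl y x; rewrite (distrC y x) => h1 h2.
by apply: le_lt_trans xy; rewrite ler_norml; apply/andP; split; lra.
Unshelve. all: by end_near. Qed.

(** The approximants are [max 0 (1 - n * dist)], with [dist] the distance to [A], which is positive
    off [A] because [A] is closed. *)
Lemma closed_indic_approx (A : set V) : closed A ->
  exists h : nat -> V -> R, [/\ forall n, continuous (h n),
    forall n x, 0 <= h n x <= 1 & forall x, h n x @[n --> \oo] --> (\1_A x : R)].
Proof.
(* The empty set is treated apart, since the distance to it would be an infimum over the empty
   set. *)
move=> cA; have [->|/set0P[a0 Aa0]] := eqVneq A set0.
  exists (fun _ => cst 0); split.
  - by move=> n; exact: cst_continuous.
  - by move=> n x /=; rewrite lexx ler01.
  - by move=> x; rewrite indic0; exact: cvg_cst.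
pose dist x := inf [set `|x - a| | a in A].
have dist_lb x : has_lbound [set `|x - a| | a in A].
  by exists 0 => _ [a _ <-].
have dist_le x a : A a -> dist x <= `|x - a|.
  by move=> Aa; apply: ge_inf => //; exists a.
have le_dist y x : (forall a, A a -> y <= `|x - a|) -> y <= dist x.
  move=> h; apply: lb_le_inf; first by exists `|x - a0|; exists a0.
  by move=> _ [a Aa <-]; exact: h.
have dist0 a : A a -> dist a = 0.
  move=> Aa; apply/eqP; rewrite eq_le; apply/andP; split.
    by have := dist_le a a Aa; rewrite subrr normr0.
  exact: le_dist.
have dist_gt0 x : ~ A x -> 0 < dist x.
  move=> nAx; have : nbhs x (~` A).
    by apply: open_nbhs_nbhs; split => //; exact: closed_openC.
  rewrite -nbhs_ballE => -[e /= e0 xe]; apply: lt_le_trans e0 _.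
  apply: le_dist => a Aa; rewrite leNgt; apply/negP => xa.
  by apply: (xe a) => //; rewrite -ball_normE.
have dist_lip x y : dist x <= `|x - y| + dist y.
  rewrite -lerBlDl; apply: le_dist => a Aa; rewrite lerBlDl.
  apply: le_trans (dist_le x a Aa) _.
  by rewrite -{1}(subrK y x) -addrA ler_normD.
have cdist : continuous dist by exact: lipschitz1_continuous.
exists (fun n x => Num.max 0 (1 - n%:R * dist x)); split.
- move=> n x; apply: (@continuous_max R V (cst 0) (fun x => 1 - n%:R * dist x)).
    exact: cst_continuous.
  apply: continuousB; first exact: cst_continuous.
  by apply: continuousM; [exact: cst_continuous|exact: cdist].
- move=> n x; rewrite le_max lexx/= ge_max ler01/= gerBl mulr_ge0//.
  exact: le_dist.
- move=> x; rewrite indicE; have [/set_mem Ax|/negP nAx] := boolP (x \in A).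
    rewrite dist0//; under eq_fun do rewrite mulr0 subr0 max_r ?ler01//.
    exact: cvg_cst.
  have dx : 0 < dist x by apply: dist_gt0 => /mem_set.
  apply: cvg_near_cst; near=> n; apply/max_idPl.
  rewrite subr_le0 -ler_pdivrMr// mul1r.
  by near: n; exact: nbhs_infty_ger.
Unshelve. all: by end_near. Qed.

End closed_approximation.

(** Dominated convergence turns equality of the integrals of [h n] into equality of the measures on
    [G], an intersection-stable generator that determines them. *)
Lemma finite_measure_unique_approx {R : realType} (d : measure_display)
    (T : measurableType d) (G : set (set T))
    (m1 m2 : {finite_measure set T -> \bar R}) :
  measurable = <<s G >> -> setI_closed G -> G setT ->
  (forall A, G A -> exists h : nat -> T -> R,
    [/\ forall n, measurable_fun setT (h n), forall n x, 0 <= h n x <= 1,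
     forall x, h n x @[n --> \oo] --> (\1_A x : R) &
     forall n, (\int[m1]_x (h n x)%:E = \int[m2]_x (h n x)%:E)%E]) ->
  forall A, measurable A -> m1 A = m2 A.
Proof.
move=> mG GI GT Gh A mA.
apply: (measure_unique G (fun=> setT) mG GI) => //.
- by rewrite bigcup_const//; exists 0%N.
- move=> B GB; have [h [mh h01 hB h12]] := Gh B GB.
  have mB : measurable B by rewrite mG; exact: sub_sigma_algebra.
  have cv (m : {finite_measure set T -> \bar R}) :
      (\int[m]_x (h n x)%:E)%E @[n --> \oo] --> m B.
    have -> : m B = (\int[m]_x (\1_B x)%:E)%E by rewrite integral_indic// setIT.
    apply: (@dominated_cvg _ _ _ m setT _ _ _ (cst 1%E)) => //.
    + by move=> n; apply/measurable_EFinP.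
    + by move=> x _; apply/cvg_EFin; [exact: nearW|exact: hB].
    + by apply: finite_measure_integrable_cst.
    + by move=> n x _ /=; rewrite lee_fin ger0_norm; have /andP[] := h01 n x.
  have := cv m1; under eq_fun do rewrite h12.
  by move=> h1; exact: (cvg_unique _ h1 (cv m2)).
- by move=> k; rewrite ltey_eq fin_num_measure.
Qed.

Section brv.
Context {R : realType}.

Lemma brv_open_measurable n (U : set 'rV[R]_n) :
  open U -> measurable (U : set (Brv R n)).
Proof. exact: sub_sigma_algebra. Qed.

Lemma brv_closed_measurable n (U : set 'rV[R]_n) :
  closed U -> measurable (U : set (Brv R n)).
Proof.
by move=> cU; rewrite -[U]setCK; apply: measurableC; apply: brv_open_measurable;
  exact: closed_openC.
Qed.

Lemma brv_compact_measurable n (K : set 'rV[R]_n) :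
  compact K -> measurable (K : set (Brv R n)).
Proof. by move=> cK; apply: brv_closed_measurable; exact: compact_closed. Qed.

Lemma brv_closed_generated n :
  @measurable _ (Brv R n) = <<s (@closed 'rV[R]_n) >>.
Proof.
apply/seteqP; split.
  apply: smallest_sub; first exact: smallest_sigma_algebra.
  move=> U oU; rewrite -[U]setCK -setTD.
  by apply: sigma_algebraCD; apply: sub_sigma_algebra; exact: open_closedC.
apply: smallest_sub; first exact: sigma_algebra_measurable.
by move=> U; exact: brv_closed_measurable.
Qed.

(** Closed rectangles are stable under intersection, and their indicators are limits of products of
    continuous functions, as needed for uniqueness on the product. *)
Lemma brv_prod_closed_generated k d :
  @measurable _ (Brv R k * Brv R d)%type =
  <<s [set A `*` B | A in @closed 'rV[R]_k & B in @closed 'rV[R]_d] >>.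
Proof.
set G := [set _ `*` _ | _ in _ & _ in _].
apply/seteqP; split; last first.
  apply: smallest_sub; first exact: sigma_algebra_measurable.
  by move=> _ [A cA [B cB <-]]; apply: measurableX; exact: brv_closed_measurable.
rewrite measurable_prod_measurableType.
apply: smallest_sub; first exact: smallest_sigma_algebra.
move=> _ [A mA [B mB <-]].
(* The product set with the sigma-algebra generated by closed rectangles: both projections are
   measurable from it, hence it contains all measurable rectangles. *)
pose T := g_sigma_algebraType G.
have m1 : measurable_fun setT (fst : T -> Brv R k).
  apply: (measurability _ (brv_closed_generated k)) => _ [C cC <-].
  rewrite setTI; apply: sub_sigma_algebra; exists C => //.
  exists setT; first exact: closedT.
  by apply/seteqP; split => x //= [].
have m2 : measurable_fun setT (snd : T -> Brv R d).
  apply: (measurability _ (brv_closed_generated d)) => _ [C cC <-].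
  rewrite setTI; apply: sub_sigma_algebra; exists setT; first exact: closedT.
  by exists C => //; apply/seteqP; split => x //= [].
have -> : A `*` B = (setT `&` fst @^-1` A) `&` (setT `&` snd @^-1` B).
  by rewrite !setTI.
exact: (@measurableI _ T _ _ (m1 measurableT A mA) (m2 measurableT B mB)).
Qed.

Lemma brv_continuous_measurable n (f : 'rV[R]_n -> R) :
  continuous f -> measurable_fun setT (f : Brv R n -> R).
Proof.
move=> cf.
have := @within_continuous_measurable R _ _ (Brv R n) idfun setT f.
rewrite preimage_setT; apply => //; first exact: brv_open_measurable.
exact: continuous_subspaceT.
Qed.

Lemma brv_coord_measurable n (i : 'I_n) :
  measurable_fun setT (fun x : Brv R n => (x : 'rV[R]_n) 0 i).
Proof. by apply: brv_continuous_measurable; exact: coord_continuous. Qed.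

Lemma rV_rat_dense n (x : 'rV[R]_n) (e : R) : 0 < e ->
  exists q : 'rV[rat]_n, ball (map_mx ratr q : 'rV[R]_n) e x.
Proof.
move=> e0.
have /choice[q xq] : forall i : 'I_n, exists q : rat, ball (ratr q : R) e (x 0 i).
  move=> i; have [|q] := @rat_in_itvoo R (x 0 i - e) (x 0 i + e); first lra.
  rewrite in_itv/= => qx; exists q; apply: ball_sym.
  by rewrite -ball_normE/= ltr_distlC.
exists (\row_i q i); split => // i j; rewrite !mxE (ord1 i); exact: xq.
Qed.

(** The product of the Borel sigma-algebras contains the open sets of the product topology, because
    these are countable unions of rational rectangles. *)
Lemma brv_prod_open_measurable k d (U : set ('rV[R]_k * 'rV[R]_d)) :
  open U -> measurable (U : set (Brv R k * Brv R d)%type).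
Proof.
move=> oU.
pose rect (i : 'rV[rat]_k * 'rV[rat]_d * nat) : set (Brv R k * Brv R d)%type :=
  (ball (map_mx ratr i.1.1 : 'rV[R]_k) i.2.+1%:R^-1) `*`
  (ball (map_mx ratr i.1.2 : 'rV[R]_d) i.2.+1%:R^-1).
have -> : U = \bigcup_i (if `[< rect i `<=` U >] then rect i else set0).
  apply/seteqP; split => [[x y] Uxy|z [i _]]; last first.
    by case: ifPn => // /asboolP; exact.
  have : nbhs (x, y) U by apply: open_nbhs_nbhs.
  rewrite -nbhs_ballE => -[e /= e0 xyU].
  (* The radius is less than [e / 2] because two points of the same small ball are within twice its
     radius. *)
  have [|N] := @ltr_add_invr R 0 (e / 2); first by rewrite divr_gt0.
  rewrite add0r => Ne.
  have N0 : 0 < N.+1%:R^-1 :> R by rewrite invr_gt0.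
  have [p px] := rV_rat_dense _ x _ N0.
  have [q qy] := rV_rat_dense _ y _ N0.
  exists (p, q, N) => //; rewrite ifT; first by split.
  apply/asboolP => -[x' y'] [/= px' qy']; apply: xyU.
  have le : N.+1%:R^-1 + N.+1%:R^-1 <= e by rewrite [leRHS]splitr lerD ?ltW.
  split => /=; apply: (le_ball le).
    by apply: ball_triangle px'; exact: ball_sym.
  by apply: ball_triangle qy'; exact: ball_sym.
apply: countable_bigcupT_measurable => // i.
case: ifPn => // _; apply: measurableX; apply: brv_open_measurable; exact: ball_open.
Qed.

Lemma brv_measure_unique n (m1 m2 : {finite_measure set (Brv R n) -> \bar R}) :
  (forall f : 'rV[R]_n -> R, continuous f -> (forall x, 0 <= f x <= 1) ->
    (\int[m1]_x (f x)%:E = \int[m2]_x (f x)%:E)%E) ->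
  forall A, measurable A -> m1 A = m2 A.
Proof.
move=> m12; apply: (finite_measure_unique_approx _ _ _ _ _ (brv_closed_generated n)).
- by move=> A B; exact: closedI.
- exact: closedT.
- move=> A /closed_indic_approx[h [ch h01 hA]]; exists h; split => // i.
    exact: brv_continuous_measurable.
  exact: m12.
Qed.

(** Test functions of product form suffice, since they approximate the indicators of closed
    rectangles. *)
Lemma brv_prod_measure_unique k d
    (m1 m2 : {finite_measure set (Brv R k * Brv R d)%type -> \bar R}) :
  (forall (f : 'rV[R]_k -> R) (g : 'rV[R]_d -> R), continuous f -> continuous g ->
    (forall x, 0 <= f x <= 1) -> (forall x, 0 <= g x <= 1) ->
    (\int[m1]_z (f z.1 * g z.2)%:E = \int[m2]_z (f z.1 * g z.2)%:E)%E) ->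
  forall A, measurable A -> m1 A = m2 A.
Proof.
move=> m12.
apply: (finite_measure_unique_approx _ _ _ _ _ (brv_prod_closed_generated k d)).
- move=> _ _ [A1 cA1 [B1 cB1 <-]] [A2 cA2 [B2 cB2 <-]].
  rewrite -setXI; exists (A1 `&` A2); first exact: closedI.
  by exists (B1 `&` B2) => //; exact: closedI.
- by exists setT; [exact: closedT|exists setT; [exact: closedT|exact: setXTT]].
- move=> _ [A cA [B cB <-]].
  have [f [cf f01 fA]] := closed_indic_approx _ cA.
  have [g [cg g01 gB]] := closed_indic_approx _ cB.
  exists (fun n z => f n z.1 * g n z.2); split => [n|n z|z|n].
  + apply: measurable_funM.
    * exact: (measurableT_comp (brv_continuous_measurable _ _ (cf n)) measurable_fst).
    * exact: (measurableT_comp (brv_continuous_measurable _ _ (cg n)) measurable_snd).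
  + have /andP[f0 f1] := f01 n z.1; have /andP[g0 g1] := g01 n z.2.
    by rewrite mulr_ge0//= mulr_ile1.
  + have -> : \1_(A `*` B) z = \1_A z.1 * \1_B z.2 :> R.
      by rewrite !indicE in_setX -natrM mulnb.
    by apply: cvgM; [exact: fA|exact: gB].
  + exact: m12.
Qed.

End brv.

(** * Image measures with density *)

Section density.
Context {R : realType} (d d' : measure_display) (T : measurableType d)
  (S : measurableType d') (theta : {measure set T -> \bar R})
  (phi : T -> S) (rho : T -> R).
Hypotheses (mphi : measurable_fun setT phi) (mrho : measurable_fun setT rho)
  (rho0 : forall z, 0 <= rho z).
Local Open Scope ereal_scope.

Definition density_image (B : set S) : \bar R :=
  \int[theta]_(z in phi @^-1` B) (rho z)%:E.

Let mpre B : measurable B -> measurable (phi @^-1` B).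
Proof. by move=> mB; rewrite -[X in measurable X]setTI; exact: mphi. Qed.

Let mErho : measurable_fun setT (EFin \o rho).
Proof. exact/measurable_EFinP. Qed.

Let density_image0 : density_image set0 = 0.
Proof. by rewrite /density_image preimage_set0 integral_set0. Qed.

Let density_image_ge0 B : 0 <= density_image B.
Proof. by apply: integral_ge0 => z _; rewrite lee_fin. Qed.

Let density_image_sigma_additive : semi_sigma_additive density_image.
Proof.
move=> F mF tF mUF.
rewrite /density_image preimage_bigcup ge0_integral_bigcup//.
- by apply: is_cvg_nneseries => n _ _; exact: density_image_ge0.
- by move=> n; exact: mpre.
- exact: measurable_funTS.
- by move=> z _; rewrite lee_fin.
- apply/trivIsetP => i j _ _ ij; rewrite -preimage_setI.
  by move/trivIsetP : tF => /(_ i j I I ij) ->; rewrite preimage_set0.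
Qed.

HB.instance Definition _ := isMeasure.Build _ _ _ density_image
  density_image0 density_image_ge0 density_image_sigma_additive.

Definition density_measure : {measure set S -> \bar R} := density_image.

Import HBNNSimple.

(** The formula holds for simple functions by linearity and passes to the limit on both sides by
    monotone convergence. *)
Lemma ge0_integral_density_measure (f : S -> \bar R) : measurable_fun setT f ->
  (forall s, 0 <= f s) ->
  \int[density_measure]_s f s = \int[theta]_z (f (phi z) * (rho z)%:E).
Proof.
move=> mf f0.
pose f_ := nnsfun_approx measurableT mf.
have mfphi n : measurable_fun setT (fun z => (f_ n (phi z))%:E).
  by apply/measurable_EFinP; exact: measurableT_comp.
transitivity (limn (fun n => \int[density_measure]_s (f_ n s)%:E)).
  rewrite -monotone_convergence//.
  - apply: eq_integral => y _; apply/esym/cvg_lim => //.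
    by apply: cvg_nnsfun_approx.
  - by move=> n; exact/measurable_EFinP/measurable_funP.
  - by move=> n y _; rewrite lee_fin.
  - by move=> y _ m n mn; rewrite lee_fin; exact/lefP/nd_nnsfun_approx.
rewrite [X in limn X](_ : _ =
    (fun n => \int[theta]_z ((f_ n (phi z))%:E * (rho z)%:E))).
  rewrite -monotone_convergence//; last 3 first.
  - by move=> n; apply: emeasurable_funM.
  - by move=> n x _ /=; rewrite mule_ge0// lee_fin.
  - move=> x _ m n mn; rewrite lee_pmul ?lee_fin//.
    exact/lefP/nd_nnsfun_approx.
  apply: eq_integral => x _ /=; apply/cvg_lim => //.
  by apply: cvgeZr => //; exact: cvg_nnsfun_approx.
(* The simple case: the sum runs over the finite range of [f_ n], and each level set contributes its
   density integral. *)
apply/funext => n; rewrite integralT_nnsfun sintegralE.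
have mpr r : measurable (f_ n @^-1` [set r]) by [].
transitivity (\sum_(k \in range (f_ n))
    \int[theta]_z (k%:E * ((\1_(f_ n @^-1` [set k]) (phi z))%:E * (rho z)%:E))).
  apply: eq_fsbigr => r /set_mem[s _ fs].
  rewrite ge0_integralZl//.
  - rewrite /= /density_image integral_mkcond; congr (_ * _).
    apply: eq_integral => z _; rewrite patchE indicE.
    have -> : (z \in phi @^-1` (f_ n @^-1` [set r])) = (phi z \in f_ n @^-1` [set r]).
      by apply/idP/idP => /set_mem h; apply/mem_set.
    by case: (phi z \in _); rewrite ?mul1e ?mul0e.
  - by apply: emeasurable_funM => //; apply/measurable_EFinP; exact: measurableT_comp.
  - by move=> z _; rewrite mule_ge0// lee_fin.
  - by rewrite lee_fin -fs.
rewrite -ge0_integral_fsum//.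
- apply: eq_integral => z _; rewrite fimfunE -fsumEFin// ge0_mule_fsuml.
    by apply: eq_fsbigr => r _; rewrite EFinM muleA.
  by move=> r; rewrite nnfun_muleindic_ge0.
- move=> r; apply: emeasurable_funM => //.
  by apply: emeasurable_funM => //; apply/measurable_EFinP; exact: measurableT_comp.
- move=> r z _; rewrite muleA; apply: mule_ge0; last by rewrite lee_fin.
  exact: nnfun_muleindic_ge0.
Qed.

End density.

(** * Change of variables for a marginal *)

Section marginal.
Context {R : realType} (d d' : measure_display) (T : measurableType d)
  (S : measurableType d') (theta : {measure set T -> \bar R})
  (m : {measure set S -> \bar R}) (phi : T -> S).
Hypotheses (mphi : measurable_fun setT phi)
  (marg : forall A, measurable A -> theta (phi @^-1` A) = m A).
Context (K : set T) (D : set S) (f : S -> R).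
Hypotheses (mK : measurable K) (mD : measurable D) (KD : forall z, K z -> D (phi z))
  (K1 : theta (~` K) = 0%E) (fi : m.-integrable D (EFin \o f)).
Local Open Scope ereal_scope.

Let intm (h : S -> \bar R) : measurable_fun setT h -> (forall s, 0 <= h s) ->
  \int[theta]_z h (phi z) = \int[m]_s h s.
Proof.
move=> mh h0; have := @ge0_integral_pushforward _ _ _ _ _ phi mphi theta setT h.
rewrite preimage_setT => <-//.
by apply: eq_measure_integral => A mA _ /=; rewrite /pushforward marg.
Qed.

(** As [f] is controlled on [D] only, it is extended by zero to a function measurable on the whole
    space. *)
Let g := (EFin \o f) \_ D.

Let mg : measurable_fun setT g.
Proof.
apply/(measurable_restrictT _ mD).
by have /integrableP[] := fi.
Qed.

Let gi : theta.-integrable setT (g \o phi).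
Proof.
apply/integrableP; split; first exact: measurableT_comp.
rewrite (intm (fun s => `|g s|)) => //; last exact: measurableT_comp.
have /integrableP[_] := fi; rewrite integral_mkcond; congr (_ < _).
by apply: eq_integral => s _; rewrite /g restrict_abse.
Qed.

Let gE z : K z -> g (phi z) = (f (phi z))%:E.
Proof. by move=> Kz; rewrite /g patchE mem_set//; exact: KD. Qed.

Lemma marginal_integrable : theta.-integrable K (fun z => (f (phi z))%:E).
Proof.
apply: (eq_integrable mK (g \o phi)); last exact: (integrableS measurableT).
by move=> z /set_mem Kz /=; exact: gE.
Qed.

(** The complement of [K] is a null set, so the integral over [K] is one over the whole space, to
    which the push-forward formula applies. *)
Lemma marginal_integral :
  \int[theta]_(z in K) (f (phi z))%:E = \int[m]_(s in D) (f s)%:E.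
Proof.
transitivity (\int[theta]_(z in K) (g (phi z))).
  by apply: eq_integral => z /set_mem Kz; rewrite gE.
have -> : K = setT `\` ~` K by rewrite setTD setCK.
rewrite -(@negligible_integral _ _ _ theta setT (~` K)) => //; last exact: measurableC.
have := @integral_pushforward _ _ _ _ _ phi mphi theta setT g mg.
rewrite preimage_setT => /(_ gi measurableT) <-.
rewrite [RHS]integral_mkcond.
by apply: eq_measure_integral => A mA _ /=; rewrite /pushforward marg.
Qed.

End marginal.

(** * Orthogonality: from continuous to integrable test functions *)

Section orthogonality.
Context {R : realType} (d : measure_display) (T : measurableType d) (n : nat)
  (theta : probability T R) (phi : T -> Brv R n) (xi : T -> R) (M : R).
Hypotheses (mphi : measurable_fun setT phi) (mxi : measurable_fun setT xi)
  (xiM : forall z, `|xi z| <= M)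
  (xi_cts : forall f : 'rV[R]_n -> R, continuous f -> (forall x, 0 <= f x <= 1) ->
    (\int[theta]_z (f (phi z) * xi z)%:E = 0)%E).
Local Open Scope ereal_scope.

(** Adding [M] makes the signed weight [xi] a nonnegative density, to be compared with the constant
    density [rho2]. *)
Let rho1 z := (xi z + M)%R.
Let rho2 (z : T) := M.

Let rho1_ge0 z : (0 <= rho1 z)%R.
Proof. by have := xiM z; rewrite /rho1 ler_norml => /andP[]; lra. Qed.

Let rho2_ge0 z : (0 <= rho2 z)%R.
Proof. exact: le_trans (xiM z). Qed.

Let mrho1 : measurable_fun setT rho1.
Proof. exact: measurable_funD. Qed.

Let mrho2 : measurable_fun setT rho2.
Proof. exact: measurable_cst. Qed.

Let bounded_integrable (h : T -> R) (N : R) : measurable_fun setT h ->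
  (forall z, (`|h z| <= N)%R) -> theta.-integrable setT (EFin \o h).
Proof.
by move=> mh hN; apply: (bounded_measurable_integrable _ _ theta setT h N).
Qed.

Let density_fin (rho : T -> R) (mrho : measurable_fun setT rho)
    (rho0 : forall z, (0 <= rho z)%R) (N : R) : (forall z, (`|rho z| <= N)%R) ->
  fin_num_fun (density_measure _ _ T (Brv R n) theta phi rho mphi mrho rho0).
Proof.
move=> rhoN B mB; apply: integrable_fin_num.
  by rewrite -[X in measurable X]setTI; exact: mphi.
apply: integrableS (bounded_integrable rho N mrho rhoN) => //.
by rewrite -[X in measurable X]setTI; exact: mphi.
Qed.

Let rho1M z : (`|rho1 z| <= M + M)%R.
Proof.
apply: le_trans (ler_normD _ _) _.
by rewrite lerD// ger0_norm//; exact: (rho2_ge0 z).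
Qed.

Let rho2M z : (`|rho2 z| <= M)%R.
Proof. by rewrite ger0_norm//; exact: (rho2_ge0 z). Qed.

Let m1 : {finite_measure set (Brv R n) -> \bar R} :=
  HB.pack (Measure.sort (density_measure _ _ _ _ theta _ _ mphi mrho1 rho1_ge0))
    (Measure_isFinite.Build _ _ _ _ (density_fin rho1 mrho1 rho1_ge0 _ rho1M)).

Let m2 : {finite_measure set (Brv R n) -> \bar R} :=
  HB.pack (Measure.sort (density_measure _ _ _ _ theta _ _ mphi mrho2 rho2_ge0))
    (Measure_isFinite.Build _ _ _ _ (density_fin rho2 mrho2 rho2_ge0 _ rho2M)).

Let int1 (f : Brv R n -> R) : measurable_fun setT f -> (forall s, (0 <= f s)%R) ->
  \int[m1]_s (f s)%:E = \int[theta]_z (f (phi z) * rho1 z)%:E.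
Proof.
move=> mf f0.
have := ge0_integral_density_measure _ _ _ _ theta _ _ mphi mrho1 rho1_ge0 (EFin \o f).
by apply; [exact/measurable_EFinP|move=> s; rewrite lee_fin].
Qed.

Let int2 (f : Brv R n -> R) : measurable_fun setT f -> (forall s, (0 <= f s)%R) ->
  \int[m2]_s (f s)%:E = \int[theta]_z (f (phi z) * M)%:E.
Proof.
move=> mf f0.
have := ge0_integral_density_measure _ _ _ _ theta _ _ mphi mrho2 rho2_ge0 (EFin \o f).
by apply; [exact/measurable_EFinP|move=> s; rewrite lee_fin].
Qed.

Let mulxi_integrable (g : T -> R) (h : T -> R) : measurable_fun setT h ->
  (forall z, (`|h z| <= M)%R) -> theta.-integrable setT (EFin \o g) ->
  theta.-integrable setT (fun z => (g z * h z)%:E).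
Proof.
move=> mh hM ig; have mg : measurable_fun setT g.
  by apply/measurable_EFinP; have /integrableP[] := ig.
apply: (@le_integrable _ _ _ theta setT measurableT _ (fun z => (M * g z)%:E)).
- by apply/measurable_EFinP; exact: measurable_funM.
- move=> z _; rewrite lee_fin !normrM mulrC (ger0_norm (rho2_ge0 z)).
  by rewrite ler_wpM2r.
- by apply: (eq_integrable measurableT (fun z => M%:E * (EFin \o g) z)) => //;
    exact: integrableZl.
Qed.

Let int12 (f : Brv R n -> R) : measurable_fun setT f ->
  theta.-integrable setT (fun z => (f (phi z))%:E) ->
  \int[theta]_z (f (phi z) * rho1 z)%:E =
  \int[theta]_z (f (phi z) * xi z)%:E + \int[theta]_z (f (phi z) * M)%:E.
Proof.
move=> mf fi; rewrite -integralD//.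
- by apply: eq_integral => z _; rewrite -EFinD -mulrDr.
- exact: mulxi_integrable.
- exact: (mulxi_integrable (f \o phi) (cst M)).
Qed.

Let m12 B : measurable B -> m1 B = m2 B.
Proof.
apply: brv_measure_unique => f cf f01.
have mf : measurable_fun setT (f : Brv R n -> R) by exact: brv_continuous_measurable.
have f0 s : (0 <= f s)%R by have /andP[] := f01 s.
rewrite int1// int2// int12//; first by rewrite xi_cts// add0e.
apply: (bounded_integrable (f \o phi) 1); first exact: measurableT_comp.
by move=> z /=; rewrite ger0_norm//; have /andP[] := f01 (phi z).
Qed.

(** Equality of [m1] and [m2] says that [f] has the same integral against [xi + M] and [M]; both
    parts being finite, the term in [M] cancels. *)
Let orthogonal_ge0 (f : Brv R n -> R) : measurable_fun setT f ->
  (forall s, (0 <= f s)%R) -> theta.-integrable setT (fun z => (f (phi z))%:E) ->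
  \int[theta]_z (f (phi z) * xi z)%:E = 0.
Proof.
move=> mf f0 fi; have := int12 f mf fi; rewrite -int1// -int2//.
rewrite (@eq_measure_integral _ _ _ setT m2 m1); last by move=> A mA _; exact: m12.
rewrite int2//.
have /fineK <- : \int[theta]_z (f (phi z) * M)%:E \is a fin_num.
  by apply: integrable_fin_num => //; exact: (mulxi_integrable (f \o phi) (cst M)).
have /fineK <- : \int[theta]_z (f (phi z) * xi z)%:E \is a fin_num.
  by apply: integrable_fin_num => //; exact: (mulxi_integrable (f \o phi) xi).
by rewrite -EFinD => -[h]; congr _%:E; lra.
Qed.

Lemma orthogonal_integrable (f : Brv R n -> R) : measurable_fun setT f ->
  theta.-integrable setT (fun z => (f (phi z))%:E) ->
  \int[theta]_z (f (phi z) * xi z)%:E = 0.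
Proof.
move=> mf fi.
pose fp s := Num.max (f s) 0%R; pose fn s := Num.max (- f s)%R 0%R.
have fE s : f s = (fp s - fn s)%R.
  by rewrite /fp /fn; have [h|h] := leP (f s) 0%R; [rewrite max_l|rewrite max_r]; lra.
have mfp : measurable_fun setT fp by apply: measurable_maxr.
have mfn : measurable_fun setT fn.
  by apply: measurable_maxr => //; exact: measurableT_comp.
have fpi : theta.-integrable setT (fun z => (fp (phi z))%:E).
  apply: le_integrable fi => //.
    by apply/measurable_EFinP; exact: measurableT_comp.
  move=> z _; rewrite lee_fin /fp.
  by have [h|h] := leP (f (phi z)) 0%R; rewrite ?normr0.
have fni : theta.-integrable setT (fun z => (fn (phi z))%:E).
  apply: le_integrable fi => //.
    by apply/measurable_EFinP; exact: measurableT_comp.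
  move=> z _; rewrite lee_fin /fn.
  by have [h|h] := leP (- f (phi z))%R 0%R; rewrite ?normr0 ?normrN.
transitivity (\int[theta]_z ((fp (phi z) * xi z)%:E - (fn (phi z) * xi z)%:E)).
  by apply: eq_integral => z _; rewrite -EFinB -mulrBl -fE.
rewrite integralB// ?orthogonal_ge0 ?sube0//.
- by move=> s; rewrite /fn le_max lexx orbT.
- by move=> s; rewrite /fp le_max lexx orbT.
- exact: (mulxi_integrable (fp \o phi) xi).
- exact: (mulxi_integrable (fn \o phi) xi).
Qed.

End orthogonality.

(** * Weak duality *)

Lemma compact_continuous_integrable {R : realType} {V : topologicalType}
    (d : measure_display) (T : measurableType d)
    (m : {finite_measure set T -> \bar R}) (e : T -> V) (K : set V) (g : V -> R) :
  (forall U, open U -> measurable (e @^-1` U)) -> measurable (e @^-1` K) ->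
  compact K -> {within K, continuous g} ->
  m.-integrable (e @^-1` K) (EFin \o (g \o e)).
Proof.
move=> me mK cK cg; have [M gM] := compact_within_continuous_bounded _ _ cK cg.
apply: (@bounded_measurable_integrable _ _ _ _ _ _ M) => //; last first.
  by move=> x; exact: gM.
exact: within_continuous_measurable.
Qed.

Lemma compact_coord_bounded {R : realType} {n : nat} (A : set 'rV[R]_n) i :
  compact A -> exists M, forall x, A x -> `|x 0 i| <= M.
Proof.
move=> cA; apply: (compact_within_continuous_bounded _ _ cA).
by apply: continuous_subspaceT; exact: coord_continuous.
Qed.

Lemma probability_setC0 {R : realType} (d : measure_display)
    (T : measurableType d) (P : probability T R) (A : set T) :
  measurable A -> P A = 1%E -> P (~` A) = 0%E.
Proof. by move=> mA PA; rewrite probability_setC// PA subee. Qed.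

Section transport.
Context {R : realType} {k d : nat} (K1 : set 'rV[R]_k) (K2 K3 : set 'rV[R]_d)
  (nu : probability (Brv R k * Brv R d)%type R) (mu : probability (Brv R d) R).
Hypotheses (cK1 : compact K1) (cK2 : compact K2) (cK3 : compact K3)
  (nuK : nu (K1 `*` K2) = 1%E) (muK : mu K3 = 1%E).
Local Notation XY := (Brv R k * Brv R d)%type.
Local Notation XYU := ((Brv R k * Brv R d) * Brv R d)%type.
Local Notation K12 := (K1 `*` K2 : set XY).
Local Notation K := ((K1 `*` K2) `*` K3 : set XYU).

Lemma K12_measurable : measurable K12.
Proof. by apply: measurableX; exact: brv_compact_measurable. Qed.

Lemma K3_measurable : measurable (K3 : set (Brv R d)).
Proof. exact: brv_compact_measurable. Qed.

Lemma K_measurable : measurable K.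
Proof. by apply: measurableX; [exact: K12_measurable|exact: K3_measurable]. Qed.

Lemma K12_integrable (psi : 'rV[R]_k * 'rV[R]_d -> R) :
  {within K1 `*` K2, continuous psi} ->
  nu.-integrable K12 (fun z : XY => (psi z)%:E).
Proof.
move=> cpsi.
apply: (@compact_continuous_integrable R _ _ XY nu idfun (K1 `*` K2) psi) => //.
- exact: brv_prod_open_measurable.
- exact: K12_measurable.
- exact: compact_setX.
Qed.

Lemma K3_integrable (f : 'rV[R]_d -> R) : {within K3, continuous f} ->
  mu.-integrable K3 (fun u : Brv R d => (f u)%:E).
Proof.
move=> cf.
apply: (@compact_continuous_integrable R _ _ (Brv R d) mu idfun K3 f) => //.
- exact: brv_open_measurable.
- exact: K3_measurable.
Qed.

Lemma coord_within_continuous n m (A : set 'rV[R]_n) (v : 'rV[R]_n -> 'rV[R]_m) i :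
  {within A, continuous v} -> {within A, continuous (fun u => v u 0 i)}.
Proof.
move=> cv.
by apply: (@within_continuous_comp _ _ _ A v (fun M : 'rV[R]_m => M 0 i)) => // x _;
  exact: coord_continuous.
Qed.

Lemma dual_values_C_sub_L1 :
  dual_values_C K1 K2 K3 nu mu `<=` dual_values_L1 K1 K2 K3 nu mu.
Proof.
move=> r [psi [phi [v [cpsi cphi cv cons ->]]]]; exists psi, phi, v; split => //.
- exact: K12_integrable.
- exact: K3_integrable.
- by move=> i; apply: K3_integrable; exact: coord_within_continuous.
Qed.

Lemma K_dotp_integrable (theta : probability XYU R) n (a b : XYU -> 'rV[R]_n) :
  (forall i, measurable_fun K (fun z => a z 0 i)) ->
  (forall i, measurable_fun K (fun z => b z 0 i)) ->
  (forall i, exists M, forall z, K z -> `|a z 0 i| <= M) ->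
  (forall i, exists M, forall z, K z -> `|b z 0 i| <= M) ->
  theta.-integrable K (fun z => (dotp (a z) (b z))%:E).
Proof.
move=> ma mb ba bb; under eq_fun do rewrite -sumEFin.
apply: (integrable_sum K_measurable) => i _.
have [Ma aM] := ba i; have [Mb bM] := bb i.
apply: (bounded_measurable_integrable _ _ theta K _ (Ma * Mb)).
- exact: K_measurable.
- exact: measurable_funM.
- by move=> z Kz; rewrite normrM ler_pM// ?aM ?bM.
Qed.

Lemma K_objective_integrable (theta : probability XYU R) :
  theta.-integrable K (fun z => (dotp z.2 z.1.2)%:E).
Proof.
apply: K_dotp_integrable => i.
- apply: measurable_funTS.
  exact: (measurableT_comp (brv_coord_measurable d i) measurable_snd).
- apply: measurable_funTS; apply: (measurableT_comp (brv_coord_measurable d i)).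
  exact: (measurableT_comp measurable_snd measurable_fst).
- have [M hM] := compact_coord_bounded K3 i cK3.
  by exists M => z [_ z3]; exact: hM.
- have [M hM] := compact_coord_bounded K2 i cK2.
  by exists M => z [[_ z2] _]; exact: hM.
Qed.

Lemma K_velocity_integrable (theta : probability XYU R) (v : 'rV[R]_d -> 'rV[R]_k) :
  {within K3, continuous v} -> theta.-integrable K (fun z => (dotp (v z.2) z.1.1)%:E).
Proof.
move=> cv; have cvi i := coord_within_continuous _ _ _ _ i cv.
apply: K_dotp_integrable => i.
- apply: (@measurable_comp _ _ _ _ _ _ (K3 : set (Brv R d)) (fun u => v u 0 i)).
  + exact: K3_measurable.
  + by move=> _ [z [_ z3] <-].
  + apply: (@within_continuous_measurable R _ _ (Brv R d) idfun K3) (cvi i).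
      exact: brv_open_measurable.
    exact: K3_measurable.
  + by apply: measurable_funTS; exact: measurable_snd.
- apply: measurable_funTS; apply: (measurableT_comp (brv_coord_measurable k i)).
  exact: (measurableT_comp measurable_fst measurable_fst).
- have [M hM] := compact_within_continuous_bounded _ _ cK3 (cvi i).
  by exists M => z [_ z3]; exact: hM.
- have [M hM] := compact_coord_bounded K1 i cK1.
  by exists M => z [[z1 _] _]; exact: hM.
Qed.

Section weak_duality.
Variable theta : probability XYU R.
Hypothesis thetaMI : MI K1 K2 K3 nu mu theta.

Let marg1 (A : set XY) : measurable A -> theta (fst @^-1` A) = nu A.
Proof.
case: thetaMI => m1 _ _ /m1 <-; congr (theta _).
by apply/seteqP; split => z //= [].
Qed.

Let marg2 (B : set (Brv R d)) : measurable B -> theta (snd @^-1` B) = mu B.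
Proof.
case: thetaMI => _ m2 _ /m2 <-; congr (theta _).
by apply/seteqP; split => z //= [].
Qed.

(** A point outside [K] has its first component outside [K12] or its second outside [K3], and the
    marginals give these two events measure zero. *)
Let thetaK : theta (~` K) = 0%E.
Proof.
apply/eqP; rewrite eq_le measure_ge0 andbT.
have -> : ~` K = fst @^-1` (~` K12) `|` snd @^-1` (~` (K3 : set (Brv R d))).
  apply/seteqP; split => [z /= zK|z /= [zK [/zK]|zK [_ /zK]]]//.
  by apply/not_andP => -[h1 h2]; apply: zK; split; exact: contrapT.
apply: le_trans (measureU2 _ _ _) _.
- rewrite -[X in measurable X]setTI; apply: measurable_fst => //.
  by apply: measurableC; exact: K12_measurable.
- rewrite -[X in measurable X]setTI; apply: measurable_snd => //.
  by apply: measurableC; exact: K3_measurable.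
rewrite [X in (X + _)%E](marg1); last by apply: measurableC; exact: K12_measurable.
rewrite [X in (_ + X)%E](marg2); last by apply: measurableC; exact: K3_measurable.
rewrite (probability_setC0 _ _ nu K12) ?(probability_setC0 _ _ mu K3) ?adde0//.
- exact: K3_measurable.
- exact: K12_measurable.
Qed.

Let coord (i : 'I_k) (z : XYU) : R := (z.1.1 : 'rV[R]_k) 0 i.

Let mcoord i : measurable_fun setT (coord i).
Proof.
apply: (measurableT_comp (brv_coord_measurable k i)).
exact: (measurableT_comp measurable_fst measurable_fst).
Qed.

(** The orthogonality result asks for a weight bounded everywhere, hence the coordinate is cut off
    outside [K]. *)
Let coord_bounded i : exists M, forall z, `|(coord i \_ K) z| <= M.
Proof.
have [M hM] := compact_coord_bounded K1 i cK1.
(* The absolute value makes the bound nonnegative, as required off [K], where the function is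
   zero. *)
exists `|M| => z; rewrite patchE; case: ifPn => [/set_mem [[/= z1 _] _]|_].
  by apply: le_trans (hM _ z1) _; exact: ler_norm.
by rewrite normr0.
Qed.

Let coordK_measurable i : measurable_fun setT (coord i \_ K).
Proof.
apply/(measurable_restrictT _ K_measurable); exact: measurable_funTS.
Qed.

(** The constraint in [MI] is tested with the field [f] times the [i]-th basis vector. *)
Let coord_cts i (f : 'rV[R]_d -> R) : continuous f -> (forall x, 0 <= f x <= 1) ->
  (\int[theta]_z (f z.2 * (coord i \_ K) z)%:E = 0)%E.
Proof.
move=> cf _; case: thetaMI => _ _ /(_ (fun u => f u *: delta_mx 0 i)).
move=> /(_ _) <-; last first.
  by apply: continuous_subspaceT => u; apply: continuousZr_tmp; exact: cf.
rewrite [RHS]integral_mkcond; apply: eq_integral => z _; rewrite !patchE.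
case: ifPn => _; last by rewrite mulr0.
congr _%:E; rewrite /dotp (bigD1 i)//= !mxE !eqxx mulr1 big1 ?addr0// => j ji.
by rewrite !mxE (negbTE ji) andbF mulr0 mul0r.
Qed.

(** Integrability comes from that of [w] under the [u]-marginal and the boundedness of the
    coordinate on [K]; the integral vanishes by orthogonality, applied to [w] extended by zero. *)
Let vx_integral (w : 'rV[R]_d -> R) (i : 'I_k) :
  mu.-integrable K3 (fun u : Brv R d => (w u)%:E) ->
  theta.-integrable K (fun z => (w z.2 * coord i z)%:E) /\
  (\int[theta]_(z in K) (w z.2 * coord i z)%:E = 0)%E.
Proof.
move=> wi; pose w' : Brv R d -> R := w \_ K3.
have w'i : mu.-integrable setT (EFin \o w').
  have := (integrable_mkcond _ K3_measurable).1 wi; congr (_.-integrable _ _).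
  by apply/funext => u; rewrite /w' /= !patchE; case: ifP.
have mw' : measurable_fun setT w' by apply/measurable_EFinP; case/integrableP : w'i.
have w'snd : theta.-integrable setT (fun z : XYU => (w' z.2)%:E).
  apply: (marginal_integrable _ _ _ _ theta mu snd measurable_snd marg2 setT setT) => //.
have E z : K z -> w z.2 * coord i z = w' z.2 * (coord i \_ K) z.
  by move=> Kz; rewrite /w' !patchE !mem_set//; case: Kz.
have [M cM] := coord_bounded i.
split.
- apply: (eq_integrable K_measurable (fun z => (w' z.2)%:E * ((coord i \_ K) z)%:E)%E).
    by move=> z /set_mem Kz; rewrite E.
  apply: integrableS (integrableMl measurableT w'snd (coordK_measurable i) _) => //.
    exact: K_measurable.
  exists M; split; first exact: num_real.
  by move=> y My z _; apply: le_trans (ltW My).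
- rewrite integral_mkcond.
  rewrite -[RHS](orthogonal_integrable _ _ _ theta snd (coord i \_ K) M measurable_snd
    (coordK_measurable i) cM (coord_cts i) w' mw' w'snd).
  apply: eq_integral => z _; rewrite patchE; case: ifPn => [/set_mem/E ->//|nK].
  by rewrite [(coord i \_ K) z]patchE (negbTE nK) mulr0.
Qed.

Lemma weak_duality_L1 r : dual_values_L1 K1 K2 K3 nu mu r ->
  (primal_obj K1 K2 K3 theta <= r)%E.
Proof.
move=> [psi [phi [v [ipsi iphi iv cons ->]]]]; rewrite /primal_obj /dual_obj.
have psiI := marginal_integrable _ _ _ _ theta nu fst measurable_fst marg1 K K12 psi
  K_measurable K12_measurable (fun z Kz => proj1 Kz) ipsi.
have phiI := marginal_integrable _ _ _ _ theta mu snd measurable_snd marg2 K K3 phi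
  K_measurable K3_measurable (fun z Kz => proj2 Kz) iphi.
have vI i := vx_integral (fun u => v u 0 i) i (iv i).
have sI : theta.-integrable K (fun z => \sum_(i < k) (v z.2 0 i * coord i z)%:E)%E.
  by apply: (integrable_sum K_measurable) => i _; case: (vI i).
rewrite -(marginal_integral _ _ _ _ theta nu fst measurable_fst marg1 K)//;
  [|exact: K_measurable|exact: K12_measurable|by move=> z []].
rewrite -(marginal_integral _ _ _ _ theta mu snd measurable_snd marg2 K)//;
  [|exact: K_measurable|exact: K3_measurable|by move=> z []].
have s0 : (\int[theta]_(z in K) (\sum_(i < k) (v z.2 0 i * coord i z)%:E) = 0)%E.
  by rewrite integral_sum; [rewrite big1// => i _; case: (vI i)|exact: K_measurable|
    by move=> i; case: (vI i)].
rewrite -integralD//; last exact: K_measurable.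
(* The vanishing velocity integral is added to the right-hand side, so that the claim becomes the
   integrated dual constraint. *)
rewrite -[leRHS]adde0 -s0 -integralD//; [|exact: K_measurable|];
  last by apply: integrableD => //; exact: K_measurable.
apply: le_integral; [exact: K_measurable|exact: K_objective_integrable| |].
  by apply: integrableD => //; [exact: K_measurable|
    apply: integrableD => //; exact: K_measurable].
move=> [[x y] u] /set_mem[[/= K1x K2y] K3u].
by rewrite sumEFin -!EFinD lee_fin; exact: cons.
Qed.

End weak_duality.

End transport.

(** * Strong duality *)

Lemma within_continuous_range_comp {S V W : topologicalType} (A : set V)
    (q : S -> V) (h : V -> W) : continuous q -> (forall s, A (q s)) ->
  {within A, continuous h} -> continuous (h \o q).
Proof.
move=> /continuousP cq Aq /continuousP ch; apply/continuousP => U oU.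
have /open_subspaceP[W' oW' WA] := ch _ oU.
have -> : (h \o q) @^-1` U = q @^-1` W'; last exact: cq.
have E (v : V) : A v -> (h @^-1` U) v = W' v.
  move=> Av; have : (h @^-1` U `&` A) v = (W' `&` A) v by rewrite WA.
  by move=> E; apply/propext; split => Hv;
    [have : (h @^-1` U `&` A) v by []; rewrite E => -[]|
     have : (W' `&` A) v by []; rewrite -E => -[]].
by apply/funext => s; exact: (E (q s) (Aq s)).
Qed.

Lemma continuous_sum {R : realType} {S : topologicalType} (I : Type) (s : seq I)
    (F : I -> S -> R) : (forall i, continuous (F i)) ->
  continuous (fun x => \sum_(i <- s) F i x).
Proof.
move=> cF; elim: s => [|i s IH].
  by under eq_fun do rewrite big_nil; exact: cst_continuous.
under eq_fun do rewrite big_cons.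
by move=> x; apply: continuousD; [exact: cF|exact: IH].
Qed.

Lemma dotp_continuous {R : realType} {S : topologicalType} n (a b : S -> 'rV[R]_n) :
  continuous a -> continuous b -> continuous (fun s => dotp (a s) (b s)).
Proof.
move=> ca cb; apply: continuous_sum => i s; apply: continuousM.
  exact: (continuous_comp (ca s) (@coord_continuous _ _ _ 0 i (a s))).
exact: (continuous_comp (cb s) (@coord_continuous _ _ _ 0 i (b s))).
Qed.

Lemma dotpDl {R : realType} n (a b x : 'rV[R]_n) : dotp (a + b) x = dotp a x + dotp b x.
Proof. by rewrite /dotp -big_split; apply: eq_bigr => i _; rewrite mxE mulrDl. Qed.

Lemma dotpZl {R : realType} n t (a x : 'rV[R]_n) : dotp (t *: a) x = t * dotp a x.
Proof. by rewrite /dotp mulr_sumr; apply: eq_bigr => i _; rewrite mxE mulrA. Qed.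

Lemma dotp0l {R : realType} n (x : 'rV[R]_n) : dotp 0 x = 0.
Proof. by rewrite -(scale0r 0) dotpZl mul0r. Qed.

Lemma probability_Rintegral_cst {R : realType} (d : measure_display)
    (T : measurableType d) (P : probability T R) (D : set T) (c : R) :
  measurable D -> P D = 1%E -> Rintegral P D (cst c) = c.
Proof. by move=> mD PD; rewrite Rintegral_cst// [X in fine X]PD mulr1. Qed.

Lemma full_measure_integral {R : realType} (d : measure_display)
    (T : measurableType d) (P : probability T R) (D : set T) (f : T -> R) :
  measurable D -> P D = 1%E -> P.-integrable setT (EFin \o f) ->
  (\int[P]_(x in D) (f x)%:E = \int[P]_x (f x)%:E)%E.
Proof.
move=> mD PD fi.
apply: (marginal_integral _ _ _ _ P P idfun _ _ D setT f) => //.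
- exact: measurable_id.
- exact: probability_setC0.
Qed.

Section strong_duality.
Context {R : realType} {k d : nat} (K1 : set 'rV[R]_k) (K2 K3 : set 'rV[R]_d)
  (nu : probability (Brv R k * Brv R d)%type R) (mu : probability (Brv R d) R).
Hypotheses (cK1 : compact K1) (cK2 : compact K2) (cK3 : compact K3)
  (nuK : nu (K1 `*` K2) = 1%E) (muK : mu K3 = 1%E)
  (centered : forall i : 'I_k,
     (\int[nu]_(z in K1 `*` K2) ((z.1 : 'rV[R]_k) 0 i)%:E)%E = 0%E).
Local Notation XY := (Brv R k * Brv R d)%type.
Local Notation XYU := ((Brv R k * Brv R d) * Brv R d)%type.
Local Notation K12 := (K1 `*` K2 : set XY).
Local Notation K := ((K1 `*` K2) `*` K3).
Local Notation Psi := ('rV[R]_k * 'rV[R]_d -> R).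
Local Notation Phi := ('rV[R]_d -> R).
Local Notation Vel := ('rV[R]_d -> 'rV[R]_k).

(** The real-valued form of [dual_obj], fit for Hahn-Banach; the two agree on continuous triples. *)
Definition dual_value (psi : Psi) (phi : Phi) : R :=
  Rintegral nu K12 psi + Rintegral mu K3 phi.

Definition continuous_triple (psi : Psi) (phi : Phi) (v : Vel) :=
  [/\ {within K1 `*` K2, continuous psi}, {within K3, continuous phi} &
      {within K3, continuous v}].

Let mK12 := K12_measurable K1 K2 cK1 cK2.
Let mK3 := K3_measurable K3 cK3.

Let ipsi psi phi v : continuous_triple psi phi v ->
  nu.-integrable K12 (EFin \o psi).
Proof. by move=> [cpsi _ _]; exact: K12_integrable. Qed.

Let iphi psi phi v : continuous_triple psi phi v ->
  mu.-integrable K3 (EFin \o phi).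
Proof. by move=> [_ cphi _]; exact: K3_integrable. Qed.

Lemma dual_objE psi phi v : continuous_triple psi phi v ->
  dual_obj K1 K2 K3 nu mu psi phi = (dual_value psi phi)%:E.
Proof.
move=> ct; rewrite EFinD /Rintegral !fineK//.
- by apply: integrable_fin_num => //; exact: iphi ct.
- by apply: integrable_fin_num => //; exact: ipsi ct.
Qed.

Lemma continuous_tripleD psi1 phi1 v1 psi2 phi2 v2 :
  continuous_triple psi1 phi1 v1 -> continuous_triple psi2 phi2 v2 ->
  continuous_triple (psi1 + psi2) (phi1 + phi2) (v1 + v2).
Proof.
move=> [c1 c2 c3] [c1' c2' c3']; split => x; apply: continuousD;
  by [exact: c1|exact: c2|exact: c3|exact: c1'|exact: c2'|exact: c3'].
Qed.

Lemma continuous_tripleZ t psi phi v : continuous_triple psi phi v ->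
  continuous_triple (t *: psi) (t *: phi) (t *: v).
Proof.
move=> [c1 c2 c3]; split => x; apply: (@continuousZl_tmp _ _ _ _ t);
  by [exact: c1|exact: c2|exact: c3].
Qed.

Lemma continuous_triple_cst a b c : continuous_triple (cst a) (cst b) (cst c).
Proof. by split => x; exact: cst_continuous. Qed.

Lemma dual_valueD psi1 phi1 v1 psi2 phi2 v2 :
  continuous_triple psi1 phi1 v1 -> continuous_triple psi2 phi2 v2 ->
  dual_value (psi1 + psi2) (phi1 + phi2) = dual_value psi1 phi1 + dual_value psi2 phi2.
Proof.
move=> c1 c2; rewrite /dual_value addrACA; congr (_ + _).
- by apply: RintegralD => //; [exact: ipsi c1|exact: ipsi c2].
- by apply: RintegralD => //; [exact: iphi c1|exact: iphi c2].
Qed.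

Lemma dual_valueZ t psi phi v : continuous_triple psi phi v ->
  dual_value (t *: psi) (t *: phi) = t * dual_value psi phi.
Proof.
move=> ct; rewrite /dual_value mulrDr; congr (_ + _).
- by apply: RintegralZl => //; exact: ipsi ct.
- by apply: RintegralZl => //; exact: iphi ct.
Qed.

Lemma dual_value_cst a b : dual_value (cst a) (cst b) = a + b.
Proof.
by rewrite /dual_value !probability_Rintegral_cst.
Qed.

(** The bound is integrated against [nu] at fixed [u], where [v u] is a constant vector and
    centering removes the velocity term, and then against [mu]. This is what keeps the price
    finite. *)
Lemma dual_value_ge psi phi v (c : R) : continuous_triple psi phi v ->
  (forall x y u, K1 x -> K2 y -> K3 u -> c <= psi (x, y) + phi u + dotp (v u) x) ->
  c <= dual_value psi phi.
Proof.
move=> ct cle.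
have cu u : K3 u -> c - Rintegral nu K12 psi <= phi u.
  move=> K3u.
  have ix (i : 'I_k) : nu.-integrable K12 (fun z : XY => ((z.1 : 'rV[R]_k) 0 i)%:E).
    apply: (K12_integrable K1 K2 nu cK1 cK2 (fun z => z.1 0 i)).
    apply: continuous_subspaceT => z.
    exact: (continuous_comp cvg_fst (@coord_continuous _ _ _ 0 i z.1)).
  have idot : nu.-integrable K12 (fun z : XY => (dotp (v u) z.1)%:E).
    under eq_fun do rewrite -sumEFin.
    apply: (integrable_sum mK12) => i _.
    by under eq_fun do rewrite EFinM; exact: integrableZl.
  have dot0 : Rintegral nu K12 (fun z : XY => dotp (v u) z.1) = 0.
    rewrite /Rintegral; under eq_integral do rewrite -sumEFin.
    rewrite integral_sum//; last first.
      by move=> i; under eq_fun do rewrite EFinM; exact: integrableZl.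
    rewrite big1// => i _; under eq_integral do rewrite EFinM.
    by rewrite integralZl// centered mule0.
  have icst (b : R) : nu.-integrable K12 (EFin \o cst b).
    exact: finite_measure_integrable_cst.
  have ipp : nu.-integrable K12 (EFin \o (fun z : XY => psi z + phi u)).
    exact: (integrableD mK12 (ipsi _ _ _ ct) (icst (phi u))).
  have : Rintegral nu K12 (cst c) <=
      Rintegral nu K12 (fun z : XY => (psi z + phi u) + dotp (v u) z.1).
    apply: le_Rintegral => //; last by move=> [x y] [/= K1x K2y]; exact: cle.
    - exact: icst.
    - exact: (integrableD mK12 ipp idot).
  rewrite RintegralD//.
  rewrite RintegralD//; [|exact: ipsi ct|exact: icst].
  rewrite dot0 probability_Rintegral_cst//.
  have -> : Rintegral nu K12 (fun=> phi u) = phi u by exact: probability_Rintegral_cst.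
  lra.
have : Rintegral mu K3 (cst (c - Rintegral nu K12 psi)) <= Rintegral mu K3 phi.
  apply: le_Rintegral => //; last exact: iphi ct.
  exact: finite_measure_integrable_cst.
by rewrite probability_Rintegral_cst// /dual_value; lra.
Qed.

(** * The price functional on the Cantor space and the optimal measure *)

Section cantor_parametrization.
Variable pi : cantor_space -> ('rV[R]_k * 'rV[R]_d) * 'rV[R]_d.
Hypotheses (cpi : continuous pi) (rpi : range pi = K).

Let piK w : K (pi w).
Proof. by rewrite -rpi; exists w. Qed.

Let pi12 w : (K1 `*` K2) (pi w).1. Proof. by case: (piK w). Qed.

Let pi3 w : K3 (pi w).2. Proof. by case: (piK w). Qed.

Let cpi1 : continuous (fun w => (pi w).1).
Proof. by move=> w; exact: (continuous_comp (cpi w) cvg_fst). Qed.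

Let cpi2 : continuous (fun w => (pi w).2).
Proof. by move=> w; exact: (continuous_comp (cpi w) cvg_snd). Qed.

Let cpi11 : continuous (fun w => (pi w).1.1).
Proof. by move=> w; exact: (continuous_comp (cpi1 w) cvg_fst). Qed.

Let cpi12 : continuous (fun w => (pi w).1.2).
Proof. by move=> w; exact: (continuous_comp (cpi1 w) cvg_snd). Qed.

Definition triple_sum (psi : Psi) (phi : Phi) (v : Vel) (w : cantor_space) : R :=
  psi (pi w).1 + phi (pi w).2 + dotp (v (pi w).2) (pi w).1.1.

Lemma triple_sum_continuous psi phi v : continuous_triple psi phi v ->
  continuous (triple_sum psi phi v).
Proof.
move=> [c1 c2 c3] w.
have h1 := within_continuous_range_comp _ _ _ cpi1 pi12 c1.
have h2 := within_continuous_range_comp _ _ _ cpi2 pi3 c2.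
have h3 := within_continuous_range_comp _ _ _ cpi2 pi3 c3.
exact: (continuousD (continuousD (h1 w) (h2 w)) (dotp_continuous _ _ _ h3 cpi11 w)).
Qed.

(** In financial terms, the costs of the positions that dominate the payoff [f]; their infimum is
    its superhedging price. *)
Definition superhedges (f : cantor_space -> R) : set R :=
  [set r | exists psi phi v, [/\ continuous_triple psi phi v,
    forall w, f w <= triple_sum psi phi v w & r = dual_value psi phi]].

Definition price (f : cantor_space -> R) : R := inf (superhedges f).

Lemma superhedges_neq0 f : bounded_function f -> superhedges f !=set0.
Proof.
move=> [M fM]; exists (dual_value (cst M) (cst 0)), (cst M), (cst 0), (cst 0).
split => //; first exact: continuous_triple_cst.
move=> w; rewrite /triple_sum dotp0l !addr0.
exact: le_trans (ler_norm _) (fM w).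
Qed.

(** By surjectivity of [pi], the bound [- M] on a triple sum along [pi] holds on all of [K], so it
    passes to the dual value. *)
Lemma superhedges_has_lbound f : bounded_function f -> has_lbound (superhedges f).
Proof.
move=> [M fM]; exists (- M) => _ [psi [phi [v [ct fle ->]]]].
apply: (dual_value_ge _ _ _ _ ct) => x y u K1x K2y K3u.
have : range pi (x, y, u) by rewrite rpi.
move=> [w _ piw]; have := fle w; rewrite /triple_sum piw/=.
by have := fM w; rewrite ler_norml => /andP[]; lra.
Qed.

Let price_le f psi phi v : bounded_function f -> continuous_triple psi phi v ->
  (forall w, f w <= triple_sum psi phi v w) -> price f <= dual_value psi phi.
Proof.
move=> bf ct fle; apply: ge_inf; first exact: superhedges_has_lbound.
by exists psi, phi, v.
Qed.

Let le_price f y : bounded_function f ->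
  (forall psi phi v, continuous_triple psi phi v ->
    (forall w, f w <= triple_sum psi phi v w) -> y <= dual_value psi phi) ->
  y <= price f.
Proof.
move=> bf yle; apply: lb_le_inf; first exact: superhedges_neq0.
by move=> _ [psi [phi [v [ct fle ->]]]]; exact: yle ct fle.
Qed.

Let triple_sumD psi1 phi1 v1 psi2 phi2 v2 w :
  triple_sum (psi1 + psi2) (phi1 + phi2) (v1 + v2) w =
  triple_sum psi1 phi1 v1 w + triple_sum psi2 phi2 v2 w.
Proof. by rewrite /triple_sum !fctE dotpDl; ring. Qed.

Let triple_sumZ t psi phi v w :
  triple_sum (t *: psi) (t *: phi) (t *: v) w = t * triple_sum psi phi v w.
Proof. by rewrite /triple_sum !fctE dotpZl /GRing.scale/=; ring. Qed.

Lemma price_sublinear : sublinear (@bounded_function R cantor_space) price.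
Proof.
split=> [f g bf bg|t f t0 bf].
- have bfg := bounded_functionD _ _ bf bg.
  rewrite -lerBlDr; apply: le_price => // psi1 phi1 v1 c1 f1.
  rewrite lerBlDr -lerBlDl; apply: le_price => // psi2 phi2 v2 c2 f2.
  rewrite lerBlDl -(dual_valueD _ _ _ _ _ _ c1 c2).
  apply: (price_le _ _ _ _ bfg (continuous_tripleD _ _ _ _ _ _ c1 c2)) => w.
  by rewrite triple_sumD lerD.
- have btf := bounded_functionZ t f bf.
  (* For [t = 0] the zero triple dominates and has value 0; otherwise dominating triples are scaled
     by [t]. *)
  have [t00|tn0] := eqVneq t 0.
    have := price_le _ _ _ _ btf (continuous_triple_cst 0 0 0).
    rewrite dual_value_cst addr0 t00 mul0r; apply => w.
    by rewrite scale0r /triple_sum dotp0l !addr0.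
  have tp : 0 < t by rewrite lt_neqAle eq_sym tn0.
  rewrite -ler_pdivrMl//; apply: le_price => // psi phi v ct fle.
  rewrite ler_pdivrMl// -(dual_valueZ _ _ _ _ ct).
  apply: (price_le _ _ _ _ btf (continuous_tripleZ t _ _ _ ct)) => w.
  by rewrite triple_sumZ ler_pM2l.
Qed.

Definition cost (w : cantor_space) : R := dotp (pi w).2 (pi w).1.2.

Lemma cost_continuous : continuous cost.
Proof. exact: dotp_continuous. Qed.

(** As [pi] maps onto [K], dominating [cost] along [pi] is the same as the dual constraint. *)
Lemma cost_price : ereal_inf (dual_values_C K1 K2 K3 nu mu) = (price cost)%:E.
Proof.
have bc := cantor_continuous_bounded _ cost_continuous.
rewrite /price -ereal_inf_EFin; last exact: superhedges_neq0; last first.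
  exact: superhedges_has_lbound.
congr ereal_inf; apply/seteqP; split.
- move=> r [psi [phi [v [c1 c2 c3 cons ->]]]].
  have ct : continuous_triple psi phi v by split.
  exists (dual_value psi phi); last by rewrite (dual_objE _ _ _ ct).
  exists psi, phi, v; split => // w.
  have [[/= h1 h2] h3] := piK w; have := cons _ _ _ h1 h2 h3.
  by rewrite -surjective_pairing.
- move=> _ [r [psi [phi [v [ct fle ->]]]] <-].
  have [c1 c2 c3] := ct; exists psi, phi, v; split => //; last first.
    by rewrite (dual_objE _ _ _ ct).
  move=> x y u K1x K2y K3u.
  have : range pi (x, y, u) by rewrite rpi.
  by move=> [w _ piw]; have := fle w; rewrite /cost /triple_sum piw.
Qed.

Lemma cantor_representation : exists m : probability cantor_borel R,
  (\int[m]_w (cost w)%:E = (price cost)%:E)%E /\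
  forall psi phi v, continuous_triple psi phi v ->
    (\int[m]_w (triple_sum psi phi v w)%:E = (dual_value psi phi)%:E)%E.
Proof.
have bc := cantor_continuous_bounded _ cost_continuous.
have [L [LD LZ Lp Lc]] := hahn_banach_dominated _ bounded_functionD bounded_functionZ
  price cost price_sublinear bc.
have LJ psi phi v : continuous_triple psi phi v ->
    L (triple_sum psi phi v) = dual_value psi phi.
  move=> ct; have bt := cantor_continuous_bounded _ (triple_sum_continuous _ _ _ ct).
  apply/eqP; rewrite eq_le; apply/andP; split.
    by apply: le_trans (Lp _ bt) _; apply: price_le ct _.
  (* The opposite triple dominates the opposite sum, so [L <= price] there bounds [L] of the sum
     from below. *)
  have := Lp _ (bounded_functionZ (-1) _ bt); rewrite LZ// => h.
  have := le_trans h (price_le _ _ _ _ (bounded_functionZ (-1) _ bt)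
    (continuous_tripleZ (-1) _ _ _ ct) _).
  rewrite (dual_valueZ _ _ _ _ ct) !mulN1r lerN2; apply => w.
  by rewrite triple_sumZ.
have [||m mE] := cantor_riesz L LD LZ.
(* Positivity: for [f >= 0] the zero triple dominates [- f], hence [L (- f) <= 0]. *)
- move=> f bf f0; have bNf := bounded_functionZ (-1) _ bf.
  have := le_trans (Lp _ bNf) (price_le _ _ _ _ bNf (continuous_triple_cst 0 0 0) _).
  rewrite dual_value_cst addr0 LZ// mulN1r oppr_le0; apply => w.
  by rewrite /triple_sum dotp0l !addr0 scaleN1r; have := f0 w; rewrite -oppr_le0.
(* Normalization: the constant 1 is the sum of the triple [(1, 0, 0)], whose dual value is 1. *)
- have := LJ _ _ _ (continuous_triple_cst 1 0 0); rewrite dual_value_cst addr0 => E.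
  by rewrite -[RHS]E; congr L; apply/funext => w; rewrite /triple_sum dotp0l !addr0.
- exists m; split; first by rewrite mE; [rewrite Lc|exact: cost_continuous].
  by move=> psi phi v ct; rewrite mE; [rewrite LJ|exact: triple_sum_continuous].
Qed.

Let mcts n (q : cantor_space -> 'rV[R]_n) : continuous q ->
  measurable_fun setT (q : cantor_borel -> Brv R n).
Proof.
move=> /continuousP cq.
apply: (@measurability _ _ cantor_borel (Brv R n) setT q (@open 'rV[R]_n) erefl).
move=> _ [U oU <-].
by rewrite setTI; exact: (@cantor_open_measurable R _ (cq _ oU)).
Qed.

Let mpi1 : measurable_fun setT ((fun w => (pi w).1) : cantor_borel -> XY).
Proof.
have := measurable_fun_pair (mcts _ _ cpi11) (mcts _ _ cpi12).
by congr (measurable_fun _ _); apply/funext => w; rewrite -surjective_pairing.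
Qed.

Let mpi : measurable_fun setT (pi : cantor_borel -> XYU).
Proof.
have := measurable_fun_pair mpi1 (mcts _ _ cpi2).
by congr (measurable_fun _ _); apply/funext => w; rewrite -surjective_pairing.
Qed.

Let piM : {mfun cantor_borel >-> XYU} :=
  HB.pack (pi : cantor_borel -> XYU) (isMeasurableFun.Build _ _ _ _ _ mpi).

Let pi1M : {mfun cantor_borel >-> XY} :=
  HB.pack ((fun w => (pi w).1) : cantor_borel -> XY)
    (isMeasurableFun.Build _ _ _ _ _ mpi1).

Let pi2M : {mfun cantor_borel >-> Brv R d} :=
  HB.pack ((fun w => (pi w).2) : cantor_borel -> Brv R d)
    (isMeasurableFun.Build _ _ _ _ _ (mcts _ _ cpi2)).

Let mT0 (m : probability cantor_borel R) : m (~` setT) = 0%E.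
Proof. by rewrite setCT measure0. Qed.

(** The optimal [theta] is the law of [pi] under the representing measure. The three conditions of
    [MI] are read off from triples with a single nonzero entry. *)
Lemma duality_attained : exists theta : probability XYU R,
  MI K1 K2 K3 nu mu theta /\
  primal_obj K1 K2 K3 theta = ereal_inf (dual_values_C K1 K2 K3 nu mu).
Proof.
have [m [mcost mtriple]] := cantor_representation.
pose theta : probability XYU R := distribution m piM.
have mK : measurable (K : set XYU) by exact: K_measurable.
have thetaE (h : XYU -> R) : theta.-integrable K (EFin \o h) ->
    (\int[theta]_(z in K) (h z)%:E = \int[m]_w (h (pi w))%:E)%E.
  move=> ih; apply/esym.
  by apply: (marginal_integral _ _ _ _ m theta pi mpi _ setT K h) => //;
    exact: mT0.
exists theta; split; last first.
  rewrite cost_price -mcost; apply: thetaE; exact: K_objective_integrable.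
split.
- move=> A mA.
  suff -> : nu A = distribution m pi1M A.
    by congr (m _); apply/seteqP; split => w //= [].
  move: A mA; apply: brv_prod_measure_unique => f g cf cg f01 g01.
  (* The triple [(psi, 0, 0)] has the integral of [psi] against [nu] as dual value, which identifies
     the first marginal. *)
  pose psi (z : 'rV[R]_k * 'rV[R]_d) := f z.1 * g z.2.
  have cpsi : continuous psi.
    move=> z; apply: continuousM.
      exact: (continuous_comp cvg_fst (cf z.1)).
    exact: (continuous_comp cvg_snd (cg z.2)).
  have ct : continuous_triple psi (cst 0) (cst 0).
    by split; [exact: continuous_subspaceT|..]; move=> x; exact: cst_continuous.
  have fgi (P : probability XY R) : P.-integrable setT (EFin \o psi).
    apply: (bounded_measurable_integrable _ _ P setT psi 1) => //.
      apply: measurable_funM.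
        exact: (measurableT_comp (brv_continuous_measurable _ _ cf) measurable_fst).
      exact: (measurableT_comp (brv_continuous_measurable _ _ cg) measurable_snd).
    move=> z _; have /andP[f0 f1] := f01 z.1; have /andP[g0 g1] := g01 z.2.
    by rewrite ger0_norm ?mulr_ge0// mulr_ile1.
  transitivity (\int[m]_w (psi (pi w).1)%:E)%E; last first.
    by apply: (marginal_integral _ _ _ _ m (distribution m pi1M) _ mpi1 _
      setT setT psi) => //; [exact: mT0|exact: fgi].
  transitivity (\int[m]_w (triple_sum psi (cst 0) (cst 0) w)%:E)%E; last first.
    by apply: eq_integral => w _; rewrite /triple_sum dotp0l !addr0.
  rewrite mtriple// /dual_value probability_Rintegral_cst// addr0 /Rintegral.
  (* The dual value integrates over [K12] only; as [nu] is carried by this set, the result is the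
     full integral. *)
  rewrite (full_measure_integral _ _ nu K12 psi mK12 nuK (fgi nu)) fineK//.
  by apply: integrable_fin_num => //; exact: fgi.
- move=> B mB.
  suff -> : mu B = distribution m pi2M B.
    by congr (m _); apply/seteqP; split => w //= [].
  move: B mB; apply: brv_measure_unique => f cf f01.
  have ct : continuous_triple (cst 0) f (cst 0).
    by split; [|exact: continuous_subspaceT|]; move=> x; exact: cst_continuous.
  have fi (P : probability (Brv R d) R) : P.-integrable setT (EFin \o f).
    apply: (bounded_measurable_integrable _ _ P setT f 1) => //.
      exact: brv_continuous_measurable.
    by move=> u _; have /andP[f0 f1] := f01 u; rewrite ger0_norm.
  transitivity (\int[m]_w (f (pi w).2)%:E)%E; last first.
    by apply: (marginal_integral _ _ _ _ m (distribution m pi2M) _ (mcts _ _ cpi2) _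
      setT setT f) => //; [exact: mT0|exact: fi].
  transitivity (\int[m]_w (triple_sum (cst 0) f (cst 0) w)%:E)%E; last first.
    by apply: eq_integral => w _; rewrite /triple_sum dotp0l addr0 add0r.
  rewrite mtriple// /dual_value probability_Rintegral_cst// add0r /Rintegral.
  rewrite (full_measure_integral _ _ mu K3 f mK3 muK (fi mu)) fineK//.
  by apply: integrable_fin_num => //; exact: fi.
- move=> v cv; rewrite thetaE; last exact: K_velocity_integrable.
  (* The triple [(0, 0, v)] has dual value 0, which is the martingale-type constraint. *)
  have ct : continuous_triple (cst 0) (cst 0) v.
    by split => //; move=> x; exact: cst_continuous.
  transitivity (\int[m]_w (triple_sum (cst 0) (cst 0) v w)%:E)%E.
    by apply: eq_integral => w _; rewrite /triple_sum !add0r.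
  by rewrite mtriple// dual_value_cst addr0.
Qed.

End cantor_parametrization.

End strong_duality.

Theorem theoremC2 (R : realType) (k d : nat)
  (K1 : set 'rV[R]_k) (K2 K3 : set 'rV[R]_d)
  (nu : probability (Brv R k * Brv R d)%type R) (mu : probability (Brv R d) R) :
  compact K1 -> compact K2 -> compact K3 ->
  (* nu is a probability measure on K1 x K2, mu on K3 *)
  nu (K1 `*` K2) = 1%E -> mu K3 = 1%E ->
  (* the first marginal m of nu is centered: int x~ m(dx~) = 0 *)
  (forall i : 'I_k,
     (\int[nu]_(z in K1 `*` K2) ((z.1 : 'rV[R]_k) 0 i)%:E)%E = 0%E) ->
  exists theta : probability ((Brv R k * Brv R d) * Brv R d)%type R,
    [/\ MI K1 K2 K3 nu mu theta,
        (forall theta' : probability ((Brv R k * Brv R d) * Brv R d)%type R,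
            MI K1 K2 K3 nu mu theta' ->
            (primal_obj K1 K2 K3 theta' <= primal_obj K1 K2 K3 theta)%E),
        primal_obj K1 K2 K3 theta = ereal_inf (dual_values_C K1 K2 K3 nu mu) &
        ereal_inf (dual_values_C K1 K2 K3 nu mu)
          = ereal_inf (dual_values_L1 K1 K2 K3 nu mu)].
Proof.
move=> cK1 cK2 cK3 nuK muK centered.
(* Sets of probability 1 are nonempty, so the product of the three compact sets is an image of the
   Cantor space. *)
have nonempty (dd : measure_display) (T : measurableType dd) (P : probability T R)
    (A : set T) : P A = 1%E -> A !=set0.
  move=> PA; apply/set0P/eqP => A0; move: PA; rewrite A0 measure0.
  by case=> /eqP; rewrite eq_sym oner_eq0.
have [z12 K12z] := nonempty _ _ _ _ nuK.
have [u K3u] := nonempty _ _ _ _ muK.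
have [||| pi [cpi rpi]] := @compact_cantor_image R
  (('rV[R]_k * 'rV[R]_d) * 'rV[R]_d)%type ((K1 `*` K2) `*` K3).
- exact: norm_hausdorff.
- by apply: compact_setX => //; exact: compact_setX.
- by exists (z12, u).
have [theta [thetaMI thetaE]] :=
  duality_attained K1 K2 K3 nu mu cK1 cK2 cK3 nuK muK centered pi cpi rpi.
have weak theta' : MI K1 K2 K3 nu mu theta' ->
    (primal_obj K1 K2 K3 theta' <= ereal_inf (dual_values_L1 K1 K2 K3 nu mu))%E.
  move=> MI'; apply: le_ereal_inf_tmp => r rL1.
  exact: (weak_duality_L1 K1 K2 K3 nu mu cK1 cK2 cK3 nuK muK theta' MI').
(* Sandwich: the continuous infimum is the primal value of [theta], hence at most the infimum in
   [L^1] by weak duality, which is at most the continuous one by inclusion. *)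
have C_L1 : ereal_inf (dual_values_C K1 K2 K3 nu mu) =
    ereal_inf (dual_values_L1 K1 K2 K3 nu mu).
  apply/eqP; rewrite eq_le -{1}thetaE weak//=.
  by apply: ereal_inf_le_tmp; exact: dual_values_C_sub_L1.
by exists theta; split => // theta' /weak; rewrite thetaE C_L1.
Qed.
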